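(* Let $\{M(t)\}$ be a generalized counting process with positive rates $\lambda_1,\dots,\lambda_k$, $\Lambda=\lambda_1+\cdots+\lambda_k$, let $\mu\in\mathbb{R}$, and let $Z^\mu(t)=\inf\{s>0:B^\mu(s)=t\}$, $t>0$, be the first-passage time of a Brownian motion $\{B^\mu(t)\}$ with drift $\mu$, independent of $\{M(t)\}$. Let $\hat M^\mu(t)=M(Z^\mu(t))$, $t>0$. The probabilities $\hat p^\mu(n,t)=\Pr\{\hat M^\mu(t)=n\}$ solve $$\frac{\mathrm{d}^2}{\mathrm{d}t^2}\hat p^\mu(n,t)-2\mu\frac{\mathrm{d}}{\mathrm{d}t}\hat p^\mu(n,t)=2\Big(\Lambda\hat p^\mu(n,t)-\sum_{j=1}^{n\wedge k}\lambda_j\hat p^\mu(n-j,t)\Big),\qquad n\ge0.$$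
   Context: Generalized counting process (GCP): for $k\ge1$ and $\lambda_1,\dots,\lambda_k>0$, it is the non-negative integer valued Lévy process $\{M(t)\}_{t\ge0}$, $M(0)=0$, with $\Pr\{M(t+h)=n+j\mid M(t)=n\}=1-\Lambda h+o(h)$ for $j=0$, $=\lambda_jh+o(h)$ for $1\le j\le k$, $=o(h)$ for $j\ge k+1$, where $\Lambda=\sum_{j=1}^k\lambda_j$. Equivalently $\mathbb{E}(u^{M(t)})=\exp(-t\sum_{j=1}^k\lambda_j(1-u^j))$ for $|u|\le1$. $B^\mu(s)=B(s)+\mu s$ with $B$ standard Brownian motion. $Z^\mu(t)$ has density $f^\mu(s,t)=\frac{t\,e^{-(t-\mu s)^2/(2s)}}{\sqrt{2\pi s^3}}$, $s>0$ (for $\mu<0$ this is defective, and $\{\hat M^\mu(t)=n\}$ means $\{Z^\mu(t)<\infty,\ M(Z^\mu(t))=n\}$), so that $\hat p^\mu(n,t)=\int_0^\infty\Pr\{M(s)=n\}f^\mu(s,t)\,\mathrm{d}s$. Notation: $n\wedge k=\min\{n,k\}$; an empty sum is $0$. *)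

(* Defs.v *)
From mathcomp Require Import all_boot all_order all_algebra.
From mathcomp Require Import all_classical all_reals all_analysis.

Set Implicit Arguments.
Unset Strict Implicit.
Unset Printing Implicit Defensive.

Import Order.TTheory GRing.Theory Num.Theory.
Import numFieldNormedType.Exports.

Local Open Scope classical_set_scope.
Local Open Scope ring_scope.

(* Continuous-time processes are functions R -> T -> V; only their values at
   times t >= 0 are constrained or used. *)
Section processes.
Context {d : measure_display} {T : measurableType d} {R : realType}.
Variable P : probability T R.

Definition is_process {d'} {V : measurableType d'} (X : R -> T -> V) : Prop :=
  forall t, 0 <= t -> measurable_fun [set: T] (X t).

Definition sigma_process {d'} {V : measurableType d'} (X : R -> T -> V) :
    set (set T) :=
  <<s \bigcup_(t in [set t : R | 0 <= t])
        preimage_set_system [set: T] (X t) measurable >>.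

Definition independent_processes {d1 d2} {V : measurableType d1}
    {W : measurableType d2} (X : R -> T -> V) (Y : R -> T -> W) : Prop :=
  forall E F, sigma_process X E -> sigma_process Y F ->
    P (E `&` F) = (P E * P F)%E.

Definition increment (X : R -> T -> R) (s t : R) (w : T) : R := X t w - X s w.

(* The A i may be taken to be setT, so the product rule for all m increments
   covers every subfamily of them. *)
Definition independent_increments (X : R -> T -> R) : Prop :=
  forall (m : nat) (t : nat -> R) (A : nat -> set R),
    0 <= t 0%N -> (forall i, (i < m)%N -> t i <= t i.+1) ->
    (forall i, (i < m)%N -> measurable (A i)) ->
    P (\bigcap_(i < m) (increment X (t i) (t i.+1) @^-1` A i)) =
    (\prod_(i < m) P (increment X (t i) (t i.+1) @^-1` A i))%E.

Definition stationary_increments (X : R -> T -> R) : Prop :=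
  forall (s t : R) (A : set R), 0 <= s -> 0 <= t -> measurable A ->
    P (increment X s (s + t) @^-1` A) = P (increment X 0 t @^-1` A).

Definition cadlag (x : R -> R) : Prop :=
  (forall t, 0 <= t -> x s @[s --> t^'+] --> x t) /\
  (forall t, 0 < t -> cvg (x s @[s --> t^'-])).

Definition levy_process (X : R -> T -> R) : Prop :=
  [/\ is_process X,
      forall w, X 0 w = 0,
      independent_increments X,
      stationary_increments X
    & forall w, cadlag (X ^~ w)].

Definition brownian_motion (B : R -> T -> R) : Prop :=
  [/\ is_process B,
      forall w, B 0 w = 0,
      independent_increments B,
      (* the second parameter of normal_prob is the standard deviation *)
      forall (s t : R) (A : set R), 0 <= s -> s < t -> measurable A ->
        P (increment B s t @^-1` A) = normal_prob 0 (Num.sqrt (t - s)) A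
    & forall w, {within `[0, +oo[, continuous (B ^~ w)}].

Definition cond_prob (E F : set T) : R := fine (P (E `&` F)) / fine (P F).

Definition total_rate (k : nat) (lambda : nat -> R) : R :=
  \sum_(1 <= j < k.+1) lambda j.

(* Pr{M(t+h) = n+j | M(t) = n} *)
Definition transition (M : R -> T -> nat) (t : R) (n j : nat) (h : R) : R :=
  cond_prob [set w | M (t + h) w = (n + j)%N] [set w | M t w = n].

(* The transition rates at (t, n) are only meaningful if Pr{M(t) = n} > 0. *)
Definition generalized_counting_process (k : nat) (lambda : nat -> R)
    (M : R -> T -> nat) : Prop :=
  [/\ is_process M,
      levy_process (fun t w => (M t w)%:R)
    & forall (t : R) (n : nat), 0 <= t -> (0 < P [set w | M t w = n])%E ->
      [/\ (fun h => transition M t n 0 h - (1 - total_rate k lambda * h))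
            =o_ (0^'+) id,
          forall j, (1 <= j <= k)%N ->
            (fun h => transition M t n j h - lambda j * h) =o_ (0^'+) id
        & forall j, (k < j)%N -> transition M t n j =o_ (0^'+) id]].

Definition drifted (B : R -> T -> R) (mu : R) (s : R) (w : T) : R :=
  B s w + mu * s.

(* +oo when the level t is never reached. *)
Definition first_passage (X : R -> T -> R) (t : R) (w : T) : \bar R :=
  ereal_inf [set s%:E | s in [set s : R | 0 < s /\ X s w = t]].

Definition phat (M : R -> T -> nat) (B : R -> T -> R) (mu : R) (n : nat)
    (t : R) : R :=
  let Z := first_passage (drifted B mu) t in
  fine (P [set w | (Z w < +oo)%E /\ M (fine (Z w)) w = n]).

End processes.

(* Main.v *)
Require Import Defs.
From mathcomp Require Import all_boot all_order all_algebra.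
From mathcomp Require Import all_classical all_reals all_analysis.
From mathcomp Require Import measurable_realfun ring lra.

Set Implicit Arguments.
Unset Strict Implicit.
Unset Printing Implicit Defensive.

Import Order.TTheory GRing.Theory Num.Theory.
Import numFieldNormedType.Exports.

Local Open Scope classical_set_scope.
Local Open Scope ring_scope.

(* For theta > 0 the first passage time Z_t of level t satisfies
     E[exp (- theta Z_t)] = exp (- t (sqrt (mu^2 + 2 theta) - mu)) :
   stop the exponential martingale of the random walk i |-> B^mu(i h) when it
   first exceeds the level and let the mesh h tend to 0.  Differentiating in
   theta, h_i(t) = E[Z_t^i exp (- theta Z_t)] is elementary and solves
     h_i'' - 2 mu h_i' = 2 theta h_i - 2 i h_{i-1}.
   The forward equations give Pr{M(s) = n} = Q_n(s) exp (- Lambda s) for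
   polynomials with Q_n' = \sum_j lambda_j Q_{n-j}.  As M is right-continuous and
   independent of Z_t, phat(n, t) = E[Q_n(Z_t) exp (- Lambda Z_t)], and the ODE at
   theta = Lambda replaces Q_n by 2 Lambda Q_n - 2 Q_n', which is the claim. *)

(** * Independence and stopped random walks *)

(** The density of the passage time never enters: since Pr{M(s) = n} is a polynomial times exp (-
    Lambda s), the transform near theta = Lambda determines phat, and derivatives in t fall on
    closed forms, never under an integral. The drift may have either sign: exp (- theta Z) counts as
    0 on Z = +oo, and sqrt (mu^2 + 2 theta) - mu is positive for every mu, which bounds the
    martingale before the level is reached. A sampled walk sees the passage late and jumps over the
    level, so the transform is bounded from the two sides by separate arguments: the lower bound
    must control the overshoot, hence a Chernoff estimate and a mesh tuned to it; the upper bound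
    passes to the limit by Fatou. Independence is given only for the sigma-algebras of M and B; this
    is why the events Z_t <= s are described by countably many coordinates of B, and why Z_t is
    rounded to a grid before M is evaluated at it. *)

Section indep.
Context d (T : measurableType d) (R : realType) (P : probability T R).
Local Open Scope ereal_scope.
(** Independence on rectangles forces the joint law of [(X, Y)] to be the product of the marginals,
    and Tonelli factors the integral. Nonnegative extended values avoid any integrability
    condition. *)
Lemma indep_integralM d1 d2 (T1 : measurableType d1) (T2 : measurableType d2)
    (X : {mfun T >-> T1}) (Y : {mfun T >-> T2}) (f : T1 -> \bar R) (g : T2 -> \bar R) :
  (forall A B, measurable A -> measurable B ->
    P (X @^-1` A `&` Y @^-1` B) = P (X @^-1` A) * P (Y @^-1` B)) ->
  measurable_fun [set: T1] f -> measurable_fun [set: T2] g ->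
  (forall x, 0 <= f x) -> (forall y, 0 <= g y) ->
  \int[P]_w (f (X w) * g (Y w)) = \int[P]_w f (X w) * \int[P]_w g (Y w).
Proof.
move=> XY mf mg f0 g0.
have mXY : measurable_fun setT (fun w => (X w, Y w)) by apply: measurable_fun_pair.
pose Z : {mfun T >-> (T1 * T2)%type} := mfun_Sub (mem_set mXY).
pose m1 := distribution P X. pose m2 := distribution P Y.
have E A : measurable A -> (m1 \x m2) A = distribution P Z A.
  by move=> mA; apply: product_measure_unique => // C D mC mD; exact: XY.
pose h (z : T1 * T2) := f z.1 * g z.2.
have mh : measurable_fun setT h.
  by apply: emeasurable_funM; [exact: measurableT_comp|exact: measurableT_comp].
have h0 z : 0 <= h z by rewrite /h mule_ge0.
transitivity (\int[m1 \x m2]_z h z).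
  rewrite -[LHS](@ge0_integral_distribution _ _ _ _ _ P Z h)//.
  by symmetry; apply: eq_measure_integral => A mA _; exact: E.
rewrite fubini_tonelli1// /fubini_F /h /=.
under eq_integral do rewrite ge0_integralZl//.
rewrite ge0_integralZr//; last exact: integral_ge0.
by rewrite !ge0_integral_distribution.
Qed.
End indep.

Section walk.
Context d (T : measurableType d) (R : realType) (P : probability T R).
Variable D : nat -> {mfun T >-> R}.

(** A pi-system generating the history of the first [i] steps, so that independence extends from
    product events to all past events by uniqueness of measures. *)
Definition past_cylinders (i : nat) : set (set T) :=
  [set C | exists A : nat -> set R, (forall j, measurable (A j)) /\
     C = \bigcap_(j < i) (D j @^-1` A j)].

Hypothesis indepD : forall m (A : nat -> set R), (forall j, measurable (A j)) ->
  P (\bigcap_(j < m) (D j @^-1` A j)) = (\prod_(j < m) P (D j @^-1` A j))%E.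

Lemma past_cylinders_measurable i : past_cylinders i `<=` measurable.
Proof.
move=> _ [A [mA ->]]; apply: bigcap_measurableType => j _.
by rewrite -[X in measurable X]setTI; exact: measurable_funPT.
Qed.

Lemma past_cylindersI i : setI_closed (past_cylinders i).
Proof.
move=> _ _ [A [mA ->]] [B [mB ->]]; exists (fun j => A j `&` B j); split.
  by move=> j; exact: measurableI.
by rewrite -bigcapI; apply: eq_bigcapr => j _; rewrite preimage_setI.
Qed.

(** As functions of [F] both sides are finite measures, one a restriction of [P] and the other a
    multiple of [P]; they agree on the cylinders by [indepD]. *)
Lemma past_indep i (F : set T) (C : set R) : measurable C ->
  <<s past_cylinders i >> F ->
  P (F `&` D i @^-1` C) = (P F * P (D i @^-1` C))%E.
Proof.
move=> mC.
have mDC : measurable (D i @^-1` C) by rewrite -[X in measurable X]setTI;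
  exact: measurable_funPT.
pose c : {nonneg R} := NngNum (fine_ge0 (measure_ge0 P (D i @^-1` C))).
pose m2 := mscale c P.
pose m1 := mrestr P mDC.
suff : forall E, <<s past_cylinders i >> E -> m1 E = m2 E.
  move=> /[apply]; rewrite /m1 /m2 /mrestr /mscale /= => ->.
  by rewrite fineK ?fin_num_measure// muleC.
have top : past_cylinders i setT.
  exists (fun=> setT); split => //; apply/esym; rewrite -subTset => w _ j _ //.
apply: (@g_sigma_algebra_measure_unique _ R T (past_cylinders i) _ (fun=> setT)) => //.
- exact: past_cylinders_measurable.
- by apply/seteqP; split => // w _; exists 0%N.
- exact: past_cylindersI.
- move=> _ [A [mA ->]]; rewrite /m1 /m2 /mrestr /mscale /= /mrestr /mscale /=.
  rewrite fineK ?fin_num_measure//.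
  (* Intersecting a cylinder of length [i] with a condition on [D i] gives a cylinder of length
     [i.+1]. *)
  pose A' j := if (j < i)%N then A j else C.
  have mA' j : measurable (A' j) by rewrite /A'; case: ifP.
  have E1 := indepD i.+1 mA'.
  have E2 := indepD i mA.
  rewrite E2 muleC; rewrite big_ord_recr /= {3}/A' ltnn in E1.
  rewrite [X in _ = (X * _)%E](eq_bigr (fun j : 'I_i => P (D j @^-1` A' j)));
    last first.
    by move=> j _; rewrite /A' ltn_ord.
  rewrite -E1; congr (P _); apply/seteqP; split => w.
    move=> [Aw Cw] j /= ji; rewrite /A'; case: ifP => [/Aw//|].
    by move=> /negbT; rewrite -leqNgt => ij; have -> : j = i by apply/eqP;
      rewrite eqn_leq ij -ltnS ji.
  move=> Aw; split => [j /= ji|].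
    by have := Aw j (ltnW ji); rewrite /A'/= ji.
  by have := Aw i (ltnSn i); rewrite /A' /= ltnn.
- move=> k; rewrite /m1 /= /mrestr; apply: (le_lt_trans (probability_le1 _ _));
  rewrite ?ltry//. by rewrite setTI.
Qed.

Lemma past_measurable i F : <<s past_cylinders i >> F -> measurable F.
Proof.
move: F; apply: smallest_sub; first exact: sigma_algebra_measurable.
exact: past_cylinders_measurable.
Qed.

Notation past i := (g_sigma_algebraType (past_cylinders i)).

Lemma past_id_measurable i : measurable_fun [set: T] (id : T -> past i).
Proof. by move=> _ F mF; rewrite setTI; exact: (@past_measurable i F mF). Qed.

(** This stands in for conditioning: the identity from [T] to [T] with the coarser sigma-algebra of
    the past is a random variable independent of [D i], and its functions are exactly the
    past-measurable ones. *)
Lemma past_integralM i (f : past i -> \bar R) (g : R -> \bar R) :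
  measurable_fun [set: past i] f -> measurable_fun [set: R] g ->
  (forall x, (0 <= f x)%E) -> (forall y, (0 <= g y)%E) ->
  (\int[P]_w (f w * g (D i w)) = \int[P]_w f w * \int[P]_w g (D i w))%E.
Proof.
move=> mf mg f0 g0.
pose X : {mfun T >-> past i} := mfun_Sub (mem_set (@past_id_measurable i)).
apply: (@indep_integralM _ _ _ P _ _ _ _ X (D i) f g) => // A B mA mB.
exact: past_indep.
Qed.

Lemma past_increment_measurable i j : (j < i)%N -> measurable_fun [set: past i] (D
  j : past i -> R).
Proof.
move=> ji _ B mB; rewrite setTI; apply: sub_gen_smallest.
exists (fun l => if l == j then B else setT); split; first by move=> l; case: ifP.
apply/seteqP; split => w /=.
  by move=> Bw l _; case: eqP => [->|].
by move=> /(_ j ji) /=; rewrite eqxx.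
Qed.

Definition partial_sum i w : R := \sum_(j < i) D j w.

Lemma past_partial_sum_measurable i j : (j <= i)%N -> measurable_fun [set: past i]
  (partial_sum j : past i -> R).
Proof.
move=> ji; apply: measurable_sum => l.
by apply: past_increment_measurable; exact: leq_trans ji.
Qed.

(** The sums of 1 up to [i] steps are constrained and the empty sum is not, so [below t 0] is the
    whole space; index [i] in [first_hit] means that the level is reached at step [i.+1]. *)
Definition below t i := [set w | forall j, (j < i)%N -> partial_sum j.+1 w < t].
Definition first_hit t i := below t i `&` [set w | t <= partial_sum i.+1 w].

Lemma past_below_measurable t i : measurable (below t i : set (past i)).
Proof.
rewrite [X in measurable X](_ : _ = \bigcap_(j < i) ((partial_sum j.+1 : past i ->
  R) @^-1` `]-oo, t[%classic)).
  apply: bigcap_measurableType => j ji.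
  rewrite -[X in measurable X]setTI.
  by apply: past_partial_sum_measurable => //.
by apply/seteqP; split => w /= H j ji; have := H j ji; rewrite /= in_itv/=.
Qed.

Lemma partial_sum_measurable i : measurable_fun [set: T] (partial_sum i).
Proof. by apply: measurable_sum => l; exact: measurable_funPT. Qed.

Lemma below_measurable t i : measurable (below t i).
Proof. by apply: (@past_measurable i); exact: past_below_measurable. Qed.

Lemma first_hit_measurable t i : measurable (first_hit t i).
Proof.
apply: measurableI; first exact: below_measurable.
rewrite [X in measurable X](_ : _ = partial_sum i.+1 @^-1` `[t, +oo[%classic).
  by rewrite -[X in measurable X]setTI; exact: partial_sum_measurable.
by apply/seteqP; split => w /=; rewrite in_itv/= andbT.
Qed.

Variables (alpha kappa : R).
Hypotheses (alpha_ge0 : 0 <= alpha) (kappa_ge0 : 0 <= kappa).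
Hypothesis mgfD : forall i, (\int[P]_w (expR (alpha * D i w - kappa))%:E = 1)%E.

(** Wald's exponential martingale: under [mgfD] each of its factors has mean 1. *)
Definition weight i w : R := expR (alpha * partial_sum i w - i%:R * kappa).

Lemma weightS i w : weight i.+1 w = weight i w * expR (alpha * D i w - kappa).
Proof.
rewrite /weight -expRD /partial_sum big_ord_recr /= -natr1; congr expR; ring.
Qed.

Lemma past_weight_measurable i : measurable_fun [set: past i] (weight i : past i -> R).
Proof.
apply: measurableT_comp => //; apply: measurable_funB => //.
by apply: measurable_funM => //; exact: past_partial_sum_measurable.
Qed.

Lemma weight_measurable i : measurable_fun [set: T] (weight i).
Proof.
apply: measurableT_comp => //; apply: measurable_funB => //.
by apply: measurable_funM => //; exact: partial_sum_measurable.
Qed.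

Definition mass i (A : set T) : \bar R := (\int[P]_w (weight i w * \1_A w)%:E)%E.

Lemma weight_indic_measurable i A : measurable A ->
  measurable_fun [set: T] (fun w => (weight i w * \1_A w)%:E).
Proof.
move=> mA; apply/measurable_EFinP; apply: measurable_funM.
  exact: weight_measurable.
exact: measurable_indic.
Qed.

Lemma mass_past i (A : set (past i)) (g : R -> R) : measurable A ->
  measurable_fun [set: R] g -> (forall y, 0 <= g y) ->
  (\int[P]_w (weight i w * \1_A w * g (D i w))%:E =
   mass i A * \int[P]_w (g (D i w))%:E)%E.
Proof.
move=> mA mg g0; under eq_integral do rewrite EFinM.
apply: (@past_integralM i (fun w => (weight i w * \1_A w)%:E) (fun y => (g y)%:E))
  => //.
- apply/measurable_EFinP; apply: measurable_funM; first exact: past_weight_measurable.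
  exact: measurable_indic.
- exact/measurable_EFinP.
- by move=> w; rewrite lee_fin mulr_ge0 ?expR_ge0.
Qed.

(** [below t i] is a past event, so multiplying by the next mean-one factor keeps its mass; the
    event is then split according to whether that step reaches [t]. *)
Lemma mass_below_step t i : mass i (below t i) =
  (mass i.+1 (below t i.+1) + mass i.+1 (first_hit t i))%E.
Proof.
transitivity (mass i.+1 (below t i)).
  rewrite /mass; under [RHS]eq_integral do rewrite weightS mulrAC.
  rewrite (@mass_past i (below t i) (fun y => expR (alpha * y - kappa))).
  - by rewrite mgfD mule1.
  - exact: past_below_measurable.
  - apply: measurableT_comp => //; apply: measurable_funB => //.
  - by move=> y; exact: expR_ge0.
rewrite /mass -ge0_integralD //=; last 4 first.
- by move=> w _; rewrite lee_fin mulr_ge0 ?expR_ge0.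
- by apply: weight_indic_measurable; exact: below_measurable.
- by move=> w _; rewrite lee_fin mulr_ge0 ?expR_ge0.
- by apply: weight_indic_measurable; exact: first_hit_measurable.
apply: eq_integral => w _; rewrite -EFinD -mulrDr; congr (_ * _)%:E.
rewrite !indicE.
have [Sw|Sw] := ltP (partial_sum i.+1 w) t.
  rewrite [w \in first_hit t i]memNset ?addr0; last by rewrite /first_hit/= leNgt
    Sw; case.
  congr (nat_of_bool _)%:R; apply/asboolP/asboolP => H j.
    by rewrite ltnS leq_eqVlt => /predU1P[-> //|]; exact: H.
  by move=> ji; apply: H; exact: leq_trans ji _.
rewrite [w \in below t i.+1]memNset ?add0r; last first.
  by move=> /(_ i (ltnSn i)); rewrite ltNge Sw.
by congr (nat_of_bool _)%:R; apply/asboolP/asboolP => [|[]].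
Qed.

(* Optional stopping for the exponential martingale [weight], spelled out as a
   telescoping sum over the step at which level [t] is first reached. *)
Lemma mass_total t N :
  (\sum_(i < N) mass i.+1 (first_hit t i) + mass N (below t N) = 1)%E.
Proof.
elim: N => [|N IH].
  rewrite big_ord0 add0e /mass (_ : below t 0 = setT); last first.
    by apply/seteqP; split => // w _ j.
  under eq_integral.
    move=> w _; rewrite indicT mulr1 /weight /partial_sum big_ord0 mulr0 mul0r
      subr0 expR0. over.
  by rewrite integral_cst//= mul1e probability_setT.
by rewrite big_ord_recr /= -addeA [X in (_ + X)%E]addeC -mass_below_step.
Qed.

Lemma weight_below_le t i w : 0 < t -> below t i w ->
  weight i w <= expR (alpha * t - i%:R * kappa).
Proof.
move=> t0 tw; rewrite ler_expR lerD2r ler_wpM2l// ltW//.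
(* The empty sum is bounded by [0 < t], not by [below]. *)
case: i tw => [|i] tw; first by rewrite /partial_sum big_ord0.
exact: tw.
Qed.

Lemma mass_below_le t i : 0 < t ->
  (mass i (below t i) <= (expR (alpha * t - i%:R * kappa))%:E)%E.
Proof.
move=> t0; apply: (@le_trans _ _ (\int[P]_w (expR (alpha * t - i%:R * kappa))%:E)%E).
  apply: ge0_le_integral => //=.
  - by move=> w _; rewrite lee_fin mulr_ge0 ?expR_ge0.
  - by apply: weight_indic_measurable; exact: below_measurable.
  - move=> w _; rewrite lee_fin indicE; have [|] := pselect (below t i w) => tw.
      by rewrite mem_set// mulr1 weight_below_le.
    by rewrite memNset// mulr0 expR_ge0.
by rewrite integral_cst//= probability_setT mule1.
Qed.

(** At the hitting step the partial sum is at least [t], which bounds the weight from below, while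
    the hitting masses add up to at most 1. *)
Lemma first_hit_laplace_le t N :
  (\sum_(i < N) (expR (- (i.+1%:R * kappa)))%:E * P (first_hit t i) <=
   (expR (- (alpha * t)))%:E)%E.
Proof.
have H i : ((expR (alpha * t))%:E * ((expR (- (i.+1%:R * kappa)))%:E * P (first_hit
  t i))
   <= mass i.+1 (first_hit t i))%E.
  rewrite muleA -EFinM -expRD.
  rewrite -(setIT (first_hit t i)) -(@integral_indic _ _ _ P _ measurableT)//;
    last exact: first_hit_measurable.
  rewrite setIT -ge0_integralZl//; last by apply/measurable_EFinP;
    apply: measurable_indic; exact: first_hit_measurable.
  apply: ge0_le_integral => //=.
  - apply/measurable_EFinP; apply: measurable_funM => //; apply: measurable_indic;
    exact: first_hit_measurable.
  - by apply: weight_indic_measurable; exact: first_hit_measurable.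
  - move=> w _; rewrite -EFinM lee_fin indicE.
    have [[_ /= tw]|tw] := pselect (first_hit t i w); last by rewrite memNset// !mulr0.
    by rewrite ler_wpM2r// ler_expR lerD2r ler_wpM2l.
have E0 : (expR (- (alpha * t)) * expR (alpha * t) = 1) by rewrite -expRD addNr expR0.
set S := (X in (X <= _)%E).
have S0 : (0 <= S)%E by apply: sume_ge0 => i _; rewrite mule_ge0// lee_fin expR_ge0.
rewrite -[S]mul1e -[1%E]/(1%:E) -E0 EFinM -muleA -[leRHS]mule1.
rewrite lee_wpmul2l// ?lee_fin ?expR_ge0// /S.
rewrite ge0_sume_distrr; last by move=> i _; rewrite mule_ge0// lee_fin expR_ge0.
rewrite -(mass_total t N); apply: (@le_trans _ _ (\sum_(i < N) mass i.+1 (first_hit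
  t i))%E).
  by apply: lee_sum => i _; exact: H.
rewrite leeDl//; by apply: integral_ge0 => w _; rewrite lee_fin mulr_ge0 ?expR_ge0.
Qed.

(* The overshoot above [t] is at most [delta] unless the hitting step itself
   exceeds [delta]; by independence the latter costs at most [tau]. *)
Lemma mass_first_hit_le t delta tau i : 0 < t -> 0 <= tau ->
  (forall i, \int[P]_w (expR (alpha * D i w - kappa) * \1_[set x : R | delta < x]
    (D i w))%:E <= tau%:E)%E ->
  (mass i.+1 (first_hit t i) <=
    (expR (alpha * (t + delta) - i.+1%:R * kappa))%:E * P (first_hit t i)
    + (expR (alpha * t) * tau)%:E)%E.
Proof.
move=> t0 tau0 Htau.
pose g y : R := expR (alpha * y - kappa) * \1_[set x : R | delta < x] y.
have mg : measurable_fun [set: R] g.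
  apply: measurable_funM; first by apply: measurableT_comp => //;
    exact: measurable_funB.
  apply: measurable_indic.
  by rewrite (_ : [set x | _] = `]delta, +oo[%classic)//; apply/seteqP;
    split => x /=; rewrite in_itv/= andbT.
have g0 y : 0 <= g y by rewrite mulr_ge0 ?expR_ge0.
apply: (@le_trans _ _ (\int[P]_w ((expR (alpha * (t + delta) - i.+1%:R * kappa))%:E
  * (\1_(first_hit t i) w)%:E
   + (weight i w * \1_(below t i) w * g (D i w))%:E))%E); last first.
  rewrite ge0_integralD//=; last 3 first.
  - apply/measurable_EFinP; apply: measurable_funM => //; apply: measurable_indic;
    exact: first_hit_measurable.
  - by move=> w _; rewrite lee_fin mulr_ge0 ?mulr_ge0 ?expR_ge0.
  - apply/measurable_EFinP; apply: measurable_funM; last exact: measurableT_comp.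
    by apply/measurable_EFinP/weight_indic_measurable; exact: below_measurable.
  apply: leeD.
    rewrite ge0_integralZl//; last first.
      by apply/measurable_EFinP; apply: measurable_indic; exact: first_hit_measurable.
    by rewrite integral_indic ?setIT//; exact: first_hit_measurable.
  rewrite (@mass_past i (below t i) g)//; last exact: past_below_measurable.
  rewrite EFinM; apply: lee_pmul => //.
  - by apply: integral_ge0 => w _; rewrite lee_fin mulr_ge0 ?expR_ge0.
  - by apply: integral_ge0 => w _; rewrite lee_fin.
  - apply: (le_trans (mass_below_le _ t0)); rewrite lee_fin ler_expR gerBl.
    by rewrite mulr_ge0.
  - exact: Htau.
apply: ge0_le_integral => //=.
- by move=> w _; rewrite lee_fin mulr_ge0 ?expR_ge0.
- by apply: weight_indic_measurable; exact: first_hit_measurable.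
- apply/measurable_EFinP; apply: measurable_funD.
    by apply: measurable_funM => //; apply: measurable_indic;
      exact: first_hit_measurable.
  apply: measurable_funM; last exact: measurableT_comp.
  by apply/measurable_EFinP/weight_indic_measurable; exact: below_measurable.
move=> w _; rewrite -EFinM -EFinD lee_fin !indicE.
have [hw|tw] := pselect (first_hit t i w); last first.
  by rewrite (memNset tw) !mulr0 add0r mulr_ge0 ?mulr_ge0 ?expR_ge0.
have [bw _] := hw; rewrite (mem_set hw) (mem_set bw) !mulr1 /g.
have [Dw|Dw] := ltP delta (D i w).
  rewrite weightS indicE mem_set//= mulr1 lerDr expR_ge0//.
rewrite indicE memNset/= ?mulr0 ?addr0; last by apply/negP; rewrite -leNgt.
rewrite ler_expR lerD2r ler_wpM2l// /partial_sum big_ord_recr/= lerD//.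
case: {+}i bw => [|j] bw; first by rewrite big_ord0 ltW.
by apply: ltW; exact: bw.
Qed.

(** The total mass 1 is the hitting mass, with overshoot at most [delta] up to [N] errors of size
    [tau], plus the mass still below the level after [N] steps. In the application [N * kappa] grows
    while [N * tau] tends to 0. *)
Lemma first_hit_laplace_ge t delta tau N : 0 < t -> 0 <= tau ->
  (forall i, \int[P]_w (expR (alpha * D i w - kappa) * \1_[set x : R | delta < x]
    (D i w))%:E <= tau%:E)%E ->
  (1 <= (expR (alpha * (t + delta)))%:E *
      (\sum_(i < N) (expR (- (i.+1%:R * kappa)))%:E * P (first_hit t i))
   + (N%:R * (expR (alpha * t) * tau) + expR (alpha * t - N%:R * kappa))%:E)%E.
Proof.
move=> t0 tau0 Htau; rewrite -(mass_total t N) EFinD [leRHS]addeA.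
apply: leeD; last exact: mass_below_le.
apply: (@le_trans _ _ (\sum_(i < N) ((expR (alpha * (t + delta) - i.+1%:R *
  kappa))%:E * P (first_hit t i)
    + (expR (alpha * t) * tau)%:E))%E).
  by apply: lee_sum => i _; exact: mass_first_hit_le.
rewrite big_split/=; apply: leeD.
  rewrite ge0_sume_distrr; last by move=> i _; rewrite mule_ge0// lee_fin expR_ge0.
  by apply: lee_sum => i _; rewrite muleA -EFinM -expRD.
by rewrite sumEFin lee_fin sumr_const card_ord mulr_natl.
Qed.
End walk.

Section first_hits.
Context d (T : measurableType d) (R : realType).

Lemma first_hit_inj (D : nat -> {mfun T >-> R}) t i j w :
  first_hit D t i w -> first_hit D t j w -> i = j.
Proof.
wlog ij : i j / (i <= j)%N.
  by move=> H hi hj; have [/H->//|/ltnW/H] := leqP i j; move=> /(_ hj hi).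
move=> [_ /= ti] [bj _]; apply/eqP; rewrite eqn_leq ij /= leqNgt; apply/negP.
by move=> /bj; rewrite ltNge ti.
Qed.

Lemma first_hit_exists (D : nat -> {mfun T >-> R}) t j w :
  t <= partial_sum D j.+1 w -> exists2 i, (i <= j)%N & first_hit D t i w.
Proof.
move=> tj.
have ex : exists i, t <= partial_sum D i.+1 w by exists j.
case: (ex_minnP ex) => i ti mini; exists i; first exact: mini.
by split => // l li; rewrite ltNge; apply/negP => /mini; rewrite leqNgt li.
Qed.

Lemma sum_first_hit_le (D : nat -> {mfun T >-> R}) t N (c : nat -> R) y w : 0 <= y ->
  (forall i, (i < N)%N -> first_hit D t i w -> c i <= y) ->
  \sum_(i < N) c i * \1_(first_hit D t i) w <= y.
Proof.
move=> y0 H; have [[i iN]|no] := pselect (exists2 i,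
  (i < N)%N & first_hit D t i w); last first.
  rewrite big1// => i _; rewrite indicE memNset ?mulr0// => hi.
  by apply: no; exists i.
move=> hi; rewrite (bigD1 (Ordinal iN))//= big1 ?addr0; last first.
  move=> j ji; rewrite indicE memNset ?mulr0// => hj.
  by move/eqP : ji; apply; apply/val_inj => /=; exact: first_hit_inj hj hi.
by rewrite indicE mem_set// mulr1; exact: H.
Qed.

Lemma le_sum_first_hit (D : nat -> {mfun T >-> R}) t N (c : nat -> R) i w :
  (forall i, 0 <= c i) -> (i < N)%N -> first_hit D t i w ->
  c i <= \sum_(i < N) c i * \1_(first_hit D t i) w.
Proof.
move=> c0 iN hi; rewrite (bigD1 (Ordinal iN))//= indicE mem_set// mulr1 lerDl.
by apply: sumr_ge0 => j _; rewrite mulr_ge0.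
Qed.
End first_hits.

(** * Auxiliary real analysis *)

Section real_analysis.
Context (R : realType).

(** This is y <= exp y at y = x e / 4, raised to the fourth power, whence 256 = 4^4. The cube is the
    number of grid steps; the factor 1/x left over makes the accumulated overshoot error vanish. *)
Lemma expR_cube_le (x e : R) : 0 < x -> 0 < e ->
  x ^+ 3 * expR (- (x * e)) <= 256 / (e ^+ 4 * x).
Proof.
move=> x0 e0.
have y0 : 0 <= x * e / 4 by rewrite divr_ge0// mulr_ge0// ltW.
have H : (x * e / 4) ^+ 4 <= expR (x * e).
  rewrite [X in _ <= expR X](_ : _ = 4%:R * (x * e / 4)); last by field.
  rewrite expRM_natl lerXn2r ?nnegrE ?expR_ge0//.
  by apply: le_trans (expR_ge1Dx _); rewrite lerDr.
rewrite expRN ler_pdivrMr ?expR_gt0//.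
apply: (@le_trans _ _ (256 / (e ^+ 4 * x) * (x * e / 4) ^+ 4)).
  rewrite le_eqVlt; apply/orP; left; apply/eqP; field.
  by rewrite !gt_eqF.
apply: ler_wpM2l => [|//]; apply: divr_ge0; first exact: ler0n.
by rewrite ltW// mulr_gt0// exprn_gt0.
Qed.

Lemma expR_neg_le (x e : R) : 0 < x -> 0 < e -> expR (- (x * e)) <= (e * x)^-1.
Proof.
move=> x0 e0; rewrite expRN lef_pV2 ?posrE ?expR_gt0 ?mulr_gt0// mulrC.
by apply: le_trans (expR_ge1Dx _); rewrite lerDr.
Qed.

(** Takes the place of limits of real sequences in the Laplace bounds, whose error terms are all
    brought to the form K / (n + 1). *)
Lemma le_of_leDharmonic (a b K : R) : (forall n : nat, a <= b + K / n.+1%:R) -> a <= b.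
Proof.
move=> H; rewrite leNgt; apply/negP => ba.
have ab0 : 0 < a - b by rewrite subr_gt0.
have := Num.Theory.truncnS_gt (K / (a - b)).
set n := Num.truncn _; rewrite ltr_pdivrMr// => Kn.
have := H n; rewrite -lerBlDl ler_pdivlMr// mulrC leNgt.
by rewrite Kn.
Qed.

Lemma limn_einf_ge (u : (\bar R)^nat) (y : \bar R) (m : nat) :
  (forall k, (m <= k)%N -> (y <= u k)%E) -> (y <= limn_einf u)%E.
Proof.
move=> H; rewrite limn_einf_lim; apply: lime_ge; first exact: is_cvg_einfs.
exists m => // n /= mn; apply: le_ereal_inf_tmp => _ [k /= nk <-].
by apply: H; exact: leq_trans nk.
Qed.

Lemma limn_einf_le (u : (\bar R)^nat) (y : \bar R) :
  (forall k, (u k <= y)%E) -> (limn_einf u <= y)%E.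
Proof.
move=> H; rewrite limn_einf_lim; apply: lime_le; first exact: is_cvg_einfs.
exists 0%N => // n _; apply: le_trans (H n); apply: ereal_inf_lbound.
by exists n => //=.
Qed.

Lemma cvg_finsum (F : set_system R) (FF : Filter F) n (f : nat -> R ->
  R) (l : nat -> R) :
  (forall i, f i h @[h --> F] --> l i) ->
  \sum_(i < n) f i h @[h --> F] --> \sum_(i < n) l i.
Proof.
move=> H; elim: n => [|n IH].
  by under eq_fun do rewrite big_ord0; rewrite big_ord0; exact: cvg_cst.
under eq_fun do rewrite big_ord_recr /=; rewrite big_ord_recr /=.
exact: cvgD.
Qed.

Lemma poly_antiderivative (S : {poly R}) : exists A : {poly R}, A^`() = S.
Proof.
exists (\poly_(i < (size S).+1) (S`_i.-1 / i%:R)); apply/polyP => i.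
rewrite coef_deriv coef_poly ltnS; case: ltnP => [_|Si] /=.
  by rewrite -[LHS]mulr_natr divfK// pnatr_eq0.
by rewrite mul0rn nth_default.
Qed.

Lemma poly_eq_pos (p q : {poly R}) : (forall s, 0 < s -> p.[s] = q.[s]) -> p = q.
Proof.
move=> pq; apply/eqP; rewrite -subr_eq0; apply/eqP.
apply: (@roots_geq_poly_eq0 _ _ [seq i.+1%:R | i <- iota 0 (size (p - q))]).
- apply/allP => _ /mapP[i _ ->]; rewrite rootE hornerD hornerN pq ?subrr//.
- by rewrite map_inj_uniq ?iota_uniq// => i j /eqP; rewrite eqr_nat => /eqP[].
- by rewrite size_map size_iota.
Qed.

Lemma is_derive0_pos_cst (f : R -> R) : (forall s : R, 0 < s -> is_derive s 1 f 0) ->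
  exists c, forall s, 0 < s -> f s = c.
Proof.
move=> f0; exists (f 1).
have main a b : 0 < a -> a < b -> f a = f b.
  move=> a0 ab; have [||c _] := @MVT R f (fun=> 0) a b ab.
  - move=> x; rewrite in_itv/= => /andP[ax _]; apply: f0; exact: lt_trans ax.
  - apply: derivable_within_continuous => x; rewrite in_itv/= => /andP[ax _].
    by have := f0 x (lt_le_trans a0 ax); case.
  - by rewrite mul0r => /eqP; rewrite subr_eq0 => /eqP.
move=> s s0; have [s1|s1|->//] := ltgtP s 1; first exact: main.
by rewrite (main 1 s).
Qed.

Lemma is_derive_expRM (a s : R) : is_derive s 1 (fun s => expR (a * s)) (a * expR
  (a * s)).
Proof.
have H := @is_derive1_comp R expR (fun s => a * s) s (expR (a * s)) a
  (is_derive_expR _).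
rewrite mulrC; apply: H.
by apply: (is_derive_eq (is_deriveZ a (is_derive_id s 1)));
  rewrite /GRing.scale /= mulr1.
Qed.

Lemma is_derive_lincomb n (c : nat -> R) (f : nat -> R -> R) (df : nat -> R) (t : R) :
  (forall i, is_derive t 1 (f i) (df i)) ->
  is_derive t 1 (fun x => \sum_(i < n) c i * f i x) (\sum_(i < n) c i * df i).
Proof.
move=> H; elim: n => [|n IH].
  rewrite big_ord0 (_ : (fun x => _) = cst 0); first exact: is_derive_cst.
  by apply/funext => x; rewrite big_ord0.
rewrite big_ord_recr /=.
have -> : (fun x => \sum_(i < n.+1) c i * f i x) = (fun x => \sum_(i < n) c i * f i
  x + c n * f n x).
  by apply/funext => x; rewrite big_ord_recr.
exact: (is_deriveD IH (is_deriveZ (c n) (H n))).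
Qed.
End real_analysis.

(** * Laplace transform of the first passage time *)

Section gauss.
Context (R : realType).
Local Notation mu := (@lebesgue_measure R).

(** The Radon-Nikodym derivative and the explicit density have the same integral over every
    measurable set, hence agree almost everywhere. *)
Lemma ge0_integral_normal_prob (m s : R) (f : R -> \bar R) :
  (forall x, (0 <= f x)%E) -> measurable_fun [set: R] f ->
  (\int[normal_prob m s]_x f x = \int[mu]_x (f x * (normal_pdf m s x)%:E))%E.
Proof.
move=> f0 mf.
have dom := normal_prob_dominates m s.
rewrite -(Radon_Nikodym_SigmaFinite.change_of_variables dom)//.
have mRN : measurable_fun setT (Radon_Nikodym_SigmaFinite.f (normal_prob m s) mu).
  exact: (measurable_int mu (Radon_Nikodym_SigmaFinite.f_integrable dom)).
apply: ae_eq_integral => //.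
- exact: emeasurable_funM.
- apply: emeasurable_funM => //; apply/measurable_EFinP; exact: measurable_normal_pdf.
- apply: ae_eqe_mul2l.
  apply: integral_ae_eq => //.
  + exact: Radon_Nikodym_SigmaFinite.f_integrable.
  + by apply/measurable_EFinP; exact: measurable_normal_pdf.
  + by move=> E _ mE; rewrite -Radon_Nikodym_SigmaFinite.f_integral.
Qed.

Lemma normal_prob_mgf (s a : R) : s != 0 ->
  (\int[normal_prob 0%R s]_x (expR (a * x))%:E = (expR (a ^+ 2 * s ^+ 2 / 2))%:E)%E.
Proof.
move=> s0; rewrite ge0_integral_normal_prob; last 2 first.
- by move=> x; rewrite lee_fin expR_ge0.
- by apply/measurable_EFinP; apply: measurableT_comp => //; exact: measurable_funM.
(* Completing the square: tilting by exp (a x) moves the mean from 0 to a s^2. *)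
transitivity (\int[mu]_x ((expR (a ^+ 2 * s ^+ 2 / 2))%:E * (normal_pdf (a * s ^+
  2) s x)%:E))%E.
  apply: eq_integral => x _; rewrite -!EFinM; congr (_%:E).
  rewrite /normal_pdf (negbTE s0) mulrCA [RHS]mulrCA; congr (_ * _).
  rewrite /normal_fun -!expRD; congr expR.
  by field.
rewrite ge0_integralZl//.
- by rewrite integral_normal_pdf mule1.
- by apply/measurable_EFinP; exact: measurable_normal_pdf.
- by move=> x _; rewrite lee_fin normal_pdf_ge0.
Qed.
End gauss.

(** * First passage of a continuous path *)

Section passage.
Context d (T : measurableType d) (R : realType) (X : R -> T -> R) (t : R) (w : T).
Hypotheses (t0 : 0 < t) (X0 : X 0 w = 0).
Hypothesis cX : {within `[0, +oo[, continuous (X ^~ w)}.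

Lemma path_near (u e : R) : 0 <= u -> 0 < e ->
  exists2 rho : R, 0 < rho & forall v : R, 0 <= v -> `|v - u| < rho ->
    `|X v w - X u w| < e.
Proof.
move=> u0 e0.
have /continuous_within_itvcyP [c1 c2] : {within `[0, +oo[,
  continuous (X ^~ w)} by exact: cX.
move: u0; rewrite le_eqVlt => /predU1P[<-|u0].
  have /cvgrPdist_lt /(_ _ e0) := c2.
  rewrite /at_right near_withinE => -[rho /= rho0 H]; exists rho => // v v0 vr.
  move: v0; rewrite le_eqVlt => /predU1P[<-|v0]; first by rewrite subrr normr0.
  by rewrite distrC; apply: H => //=; rewrite distrC.
have /c1 : u \in `]0, +oo[ by rewrite in_itv/= u0.
move=> /cvgrPdist_lt /(_ _ e0) [rho /= rho0 H]; exists rho => // v v0 vr.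
by rewrite distrC; apply: H => //=; rewrite distrC.
Qed.

(** A path starting at 0 that is at or above [t] at some time has hit [t] exactly by then, by the
    intermediate value theorem. Conversely, a path below [t] on all of [0, s] stays below [t] a
    little beyond [s] by continuity, which pushes the infimum strictly past [s]. *)
Lemma first_passage_le (s : R) : 0 <= s ->
  (first_passage X t w <= s%:E)%E <-> exists2 u : R, 0 <= u <= s & t <= X u w.
Proof.
move=> s0; split; last first.
  move=> [u /andP[u0 us] tu].
  have cu : {within `[0, u], continuous (X ^~ w)}.
    apply: continuous_subspaceW cX => x /=; rewrite !in_itv/= andbT.
    by case/andP.
  have [|c + Xc] := @IVT R (X ^~ w) 0 u t u0 cu.
    by rewrite X0 ge_min (ltW t0) le_max tu orbT.
  rewrite in_itv/= => /andP[c0 cle]; apply: (@le_trans _ _ c%:E).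
    apply: ereal_inf_lbound; exists c => //; split => //.
    by rewrite lt_neqAle c0 andbT; apply/eqP => c00; move: Xc t0;
      rewrite -c00 X0 => <-; rewrite ltxx.
  by rewrite lee_fin (le_trans cle).
move=> Zs; apply: contrapT => H.
have {}H u : 0 <= u -> u <= s -> X u w < t.
  by move=> u0 us; rewrite ltNge; apply/negP => tu; apply: H; exists u => //;
    rewrite u0 us.
have Xs : 0 < t - X s w by rewrite subr_gt0 H.
have [rho rho0 Hrho] := path_near s0 Xs.
suff : ((s + rho)%:E <= first_passage X t w)%E.
  by move=> /le_trans /(_ Zs); rewrite lee_fin leNgt ltrDl rho0.
apply: le_ereal_inf_tmp => _ [u /= [u0 Xu] <-]; rewrite lee_fin leNgt; apply/negP => us.
have [us'|us'] := leP u s; first by have := H u (ltW u0) us'; rewrite Xu ltxx.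
have /Hrho : `|u - s| < rho by rewrite gtr0_norm ?subr_gt0// ltrBlDl.
rewrite Xu => /(_ (ltW u0)); rewrite gtr0_norm ?ltxx//.
Qed.

Lemma first_passage_ge0 : (0 <= first_passage X t w)%E.
Proof. by apply: le_ereal_inf_tmp => _ [u /= [u0 _] <-]; rewrite lee_fin ltW. Qed.

(** Makes the passage event countable. A path reaching [t] at [u] exceeds any lower level at a grid
    time just left of [u], hence still at most [s]; conversely, near misses of every order force the
    maximum over the compact [0, s] to be at least [t]. *)
Lemma passage_gridP (s : R) : 0 <= s ->
  (exists2 u : R, 0 <= u <= s & t <= X u w) <->
  (forall j : nat, exists m i : nat, i%:R / m.+1%:R <= s /\ t - j.+1%:R^-1 < X
    (i%:R / m.+1%:R) w).
Proof.
move=> s0; split.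
  move=> [u /andP[u0 us] tu] j.
  have j0 : 0 < j.+1%:R^-1 :> R by rewrite invr_gt0.
  have [rho rho0 Hrho] := path_near u0 j0.
  have [m mrho] : exists m : nat, rho^-1 < m.+1%:R.
    exists (Num.truncn rho^-1); apply: Num.Theory.truncnS_gt.
  have m0 : 0 < m.+1%:R :> R by [].
  pose i := Num.truncn (u * m.+1%:R).
  have um0 : 0 <= u * m.+1%:R by rewrite mulr_ge0.
  have /andP[i1 i2] := Num.Theory.truncn_itv um0.
  have iu : i%:R / m.+1%:R <= u by rewrite ler_pdivrMr.
  exists m, i; split; first exact: le_trans us.
  have ui : u - i%:R / m.+1%:R < rho.
    apply: (@lt_trans _ _ m.+1%:R^-1); last by rewrite invf_plt.
    by rewrite ltrBlDr -[X in X + _]mul1r -mulrDl ltr_pdivlMr// nat1r.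
  have /Hrho : `|i%:R / m.+1%:R - u| < rho by rewrite distrC ger0_norm ?subr_ge0.
  move=> /(_ (divr_ge0 (ler0n _ _) (ler0n _ _))).
  by rewrite ltr_distl => /andP[+ _]; apply: le_lt_trans; rewrite lerD2r.
move=> H.
have cs : {within `[0, s], continuous (X ^~ w)}.
  apply: continuous_subspaceW cX => x /=; rewrite !in_itv/= andbT.
  by case/andP.
have [c cs0 cmax] := EVT_max s0 cs.
exists c => //; rewrite leNgt; apply/negP => Xct.
have tc : 0 < t - X c w by rewrite subr_gt0.
have := Num.Theory.truncnS_gt (t - X c w)^-1.
set j := Num.truncn _ => jc.
have [m [i [is_ Xi]]] := H j.
have := cmax (i%:R / m.+1%:R).
rewrite in_itv/= is_ divr_ge0//= => /(_ isT).
rewrite leNgt => /negP; apply; apply: le_lt_trans Xi.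
rewrite lerBrDr -lerBrDl invf_ple ?posrE//; exact: ltW.
Qed.
End passage.

Section on_finite.
Context (R : realType).
(* A function of the passage time counts as [0] when the level is never reached. *)
Definition on_finite (g : R -> R) (z : \bar R) : R := if z is r%:E then g r else 0.

Lemma on_finite_measurable (g : R -> R) : measurable_fun [set: R] g ->
  measurable_fun [set: \bar R] (on_finite g).
Proof.
move=> mg.
rewrite (_ : on_finite g = (fun z => if z \is a fin_num then g (fine z) else 0));
  last first.
  by apply/funext => -[].
apply: measurable_fun_ifT.
- apply: (measurable_fun_bool true).
  by have := emeasurable_fin_num measurableT (@measurable_id _ (\bar R) setT).
- by apply: measurableT_comp => //; exact: measurable_fine.
- exact: measurable_cst.
Qed.

Lemma on_finite_ge0 (g : R -> R) z : (forall x, 0 <= g x) -> 0 <= on_finite g z.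
Proof. by case: z => /=. Qed.
End on_finite.

Lemma sigma_process_measurable d (T : measurableType d) (R : realType) d'
  (V : measurableType d') (X : R -> T -> V) : is_process X ->
  sigma_process X `<=` measurable.
Proof.
move=> mX; apply: smallest_sub; first exact: sigma_algebra_measurable.
by move=> _ [s s0 [A mA <-]]; exact: mX.
Qed.

(** * Passage times of a drifted Brownian motion *)

Section brownian_passage.
Context d (T : measurableType d) (R : realType) (P : probability T R).
Variables (B : R -> T -> R) (mu : R).
Hypothesis B_bm : brownian_motion P B.
Notation X := (drifted B mu).

Lemma drifted_continuous w : {within `[0, +oo[, continuous (X ^~ w)}.
Proof.
have [_ _ _ _ cB] := B_bm.
move=> x; apply: cvgD; first exact: cB.
apply: (@continuous_subspaceT _ _ _ (fun s : R => mu * s)).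
by move=> y; exact: mulrl_continuous.
Qed.

Lemma drifted0 w : X 0 w = 0.
Proof. by have [_ B0 _ _ _] := B_bm; rewrite /drifted B0 mulr0 addr0. Qed.

(** Stronger than measurability in [T]: independence from the counting process is available only for
    events generated by [B]. *)
Lemma first_passage_sigma (t s : R) : 0 < t ->
  sigma_process B [set w | (first_passage X t w <= s%:E)%E].
Proof.
move=> t0.
have [s0|s0] := leP 0 s; last first.
  rewrite (_ : [set _ | _] = set0); last first.
    apply/seteqP; split => // w /=; apply/negP; rewrite -ltNge.
    by rewrite (lt_le_trans _ (first_passage_ge0 _ _ _))// lte_fin.
  exact: (@measurable0 _ (g_sigma_algebraType _)).
rewrite (_ : [set _ | _] = \bigcap_(j in setT) \bigcup_(m in setT) \bigcup_(i in
  [set i : nat | (i%:R / m.+1%:R <= s)])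
   [set w | t - j.+1%:R^-1 < X (i%:R / m.+1%:R) w]); last first.
  apply/seteqP; split => w /=.
    move/(first_passage_le t0 (drifted0 w) (@drifted_continuous w) s0).
    move/(passage_gridP t (@drifted_continuous w) s0) => H j _.
    by have [m [i [h1 h2]]] := H j; exists m => //; exists i.
  move=> H.
  apply/(first_passage_le t0 (drifted0 w) (@drifted_continuous w) s0).
  apply/(passage_gridP t (@drifted_continuous w) s0) => j.
  by have [m _ [i h1 h2]] := H j I; exists m, i.
apply: (@bigcap_measurableType _ (g_sigma_algebraType _)) => j _.
apply: (@bigcup_measurable _ (g_sigma_algebraType _)) => m _.
apply: (@bigcup_measurable _ (g_sigma_algebraType _)) => i _.
apply: sub_sigma_algebra; exists (i%:R / m.+1%:R); first by rewrite /= divr_ge0.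
exists `](t - j.+1%:R^-1 - mu * (i%:R / m.+1%:R)), +oo[%classic => //.
by rewrite setTI; apply/funext => w; apply/propext; rewrite /= in_itv/= andbT
  /drifted ltrBlDr.
Qed.

Lemma first_passage_measurable (t : R) : 0 < t ->
  measurable_fun [set: T] (first_passage X t).
Proof.
move=> t0; have [mB _ _ _ _] := B_bm.
move=> mT; apply: (measurability _ (ErealGenOInfty.measurableE R)) => // _ [_ [x
  ->] <-].
rewrite setTI preimage_itvoy.
rewrite (_ : [set _ | _] = ~` [set w | (first_passage X t w <= x%:E)%E]); last first.
  by apply/seteqP; split => w /=; [move=> h; apply/negP; rewrite -ltNge|move/negP;
    rewrite -ltNge].
by apply: measurableC; apply: (sigma_process_measurable mB); exact: first_passage_sigma.
Qed.

Section step.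
Variable h : R.
Hypothesis h0 : 0 < h.

Definition step_fun i w : R := X (i.+1%:R * h) w - X (i%:R * h) w.

Lemma step_funE i w : step_fun i w = increment B (i%:R * h) (i.+1%:R * h) w + mu * h.
Proof. by rewrite /step_fun /drifted /increment -natr1; ring. Qed.

Lemma drifted_measurable s : 0 <= s -> measurable_fun [set: T] (X s).
Proof.
by have [mB _ _ _ _] := B_bm; move=> s0; apply: measurable_funD => //; exact: mB.
Qed.

Lemma increment_measurable s u : 0 <= s -> 0 <= u -> measurable_fun [set: T]
  (increment B s u).
Proof.
by have [mB _ _ _ _] := B_bm; move=> s0 u0; apply: measurable_funB; exact: mB.
Qed.

Lemma grid_ge0 i : 0 <= i%:R * h. Proof. by rewrite mulr_ge0// ltW. Qed.

Lemma step_fun_measurable i : measurable_fun [set: T] (step_fun i).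
Proof. by apply: measurable_funB; apply: drifted_measurable; exact: grid_ge0. Qed.

Definition step i : {mfun T >-> R} := mfun_Sub (mem_set (step_fun_measurable i)).

Lemma step_indep m (A : nat -> set R) : (forall j, measurable (A j)) ->
  P (\bigcap_(j < m) (step j @^-1` A j)) = (\prod_(j < m) P (step j @^-1` A j))%E.
Proof.
move=> mA; have [_ _ iB _ _] := B_bm.
pose A' j := (fun x => x + mu * h) @^-1` A j.
have mA' j : measurable (A' j).
  by rewrite -[X in measurable X]setTI; apply: measurable_funD.
have E j : step j @^-1` A j = increment B (j%:R * h) (j.+1%:R * h) @^-1` A' j.
  by apply/funext => w; rewrite /A' /= step_funE.
under eq_bigr do rewrite E.
under eq_bigcapr do rewrite E.
apply: (iB m (fun j => j%:R * h)) => //; first by rewrite mul0r.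
by move=> i _; rewrite ler_pM2r// ler_nat.
Qed.

Lemma step_partial_sum i w : partial_sum step i w = X (i%:R * h) w.
Proof.
elim: i => [|i IH]; first by rewrite /partial_sum big_ord0 mul0r drifted0.
rewrite /partial_sum big_ord_recr /= -/(partial_sum step i w) IH /step_fun; ring.
Qed.

Lemma integral_step i (g : R -> \bar R) : measurable_fun [set: R] g -> (forall x,
  0 <= g x)%E ->
  (\int[P]_w g (step i w) = \int[normal_prob 0%R (Num.sqrt h)]_x g (x + mu * h)%R)%E.
Proof.
move=> mg g0; have [_ _ _ gB _] := B_bm.
(* [normal_prob] lives on this type, only convertible to [R]. *)
pose RB := g_sigma_algebraType (R.-ocitv.-measurable).
pose Y0 (w : T) : RB := increment B (i%:R * h) (i.+1%:R * h) w.
have mY : measurable_fun [set: T] Y0.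
  by apply: increment_measurable; exact: grid_ge0.
pose Y : {mfun T >-> RB} := mfun_Sub (mem_set mY).
transitivity (\int[distribution P Y]_x g (x + mu * h)%R)%E; last first.
  apply: eq_measure_integral => A mA _; rewrite /distribution /pushforward.
  have hh : i.+1%:R * h - i%:R * h = h by rewrite -natr1; ring.
  have := gB (i%:R * h) (i.+1%:R * h) A (grid_ge0 i).
  by rewrite -subr_gt0 hh; apply.
rewrite ge0_integral_distribution//; last first.
  by apply: measurableT_comp => //; exact: measurable_funD.
by apply: eq_integral => w _; rewrite /= step_funE.
Qed.

Lemma step_mgf i (a : R) :
  (\int[P]_w (expR (a * step i w))%:E = (expR (a * mu * h + a ^+ 2 * h / 2))%:E)%E.
Proof.
rewrite (@integral_step i (fun x => (expR (a * x))%:E)); last 2 first.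
- by apply/measurable_EFinP; apply: measurableT_comp => //; exact: measurable_funM.
- by move=> x; rewrite lee_fin expR_ge0.
under eq_integral do rewrite mulrDr addrC expRD EFinM.
rewrite ge0_integralZl//; last first.
  by apply/measurable_EFinP; apply: measurableT_comp => //; exact: measurable_funM.
rewrite normal_prob_mgf ?gt_eqF ?sqrtr_gt0// sqr_sqrtr ?ltW//.
by rewrite -EFinM -expRD mulrA.
Qed.
End step.

Variable theta : R.
Hypothesis theta0 : 0 < theta.
(** The positive root a of a mu + a^2 / 2 = theta, for which exp (a B^mu(s) - theta s) is a
    martingale. *)
Definition laplace_exponent := Num.sqrt (mu ^+ 2 + 2 * theta) - mu.
Notation alpha := laplace_exponent.

Lemma laplace_exponent_root : alpha * mu + alpha ^+ 2 / 2 = theta.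
Proof.
have : Num.sqrt (mu ^+ 2 + 2 * theta) ^+ 2 = mu ^+ 2 + 2 * theta.
  by rewrite sqr_sqrtr// addr_ge0 ?sqr_ge0// mulr_ge0// ltW.
rewrite /alpha; set r := Num.sqrt _ => r2.
have -> : theta = (r ^+ 2 - mu ^+ 2) / 2 by rewrite r2; field.
by field.
Qed.

Lemma laplace_exponent_gt0 : 0 < alpha.
Proof.
rewrite subr_gt0; apply: (le_lt_trans (ler_norm mu)); rewrite -sqrtr_sqr ltr_sqrt.
  by rewrite ltrDl mulr_gt0.
by rewrite ltr_wpDl ?sqr_ge0// mulr_gt0.
Qed.

Lemma step_mgf1 (h : R) (h0 : 0 < h) i :
  (\int[P]_w (expR (alpha * step h0 i w - theta * h))%:E = 1)%E.
Proof.
under eq_integral do rewrite expRD EFinM.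
rewrite ge0_integralZr//; last first.
  by apply/measurable_EFinP; apply: measurableT_comp => //; exact: measurable_funM.
rewrite step_mgf -EFinM -expRD.
rewrite [X in expR X](_ : _ = (alpha * mu + alpha ^+ 2 / 2 - theta) * h); last by field.
by rewrite laplace_exponent_root subrr mul0r expR0.
Qed.

(* Chernoff bound: [\1_(delta < x) <= expR (c * (x - delta))]. *)
Lemma step_tail (h : R) (h0 : 0 < h) i (c delta : R) : 0 <= c ->
  (\int[P]_w (expR (alpha * step h0 i w - theta * h) * \1_[set x : R | (delta <
    x)%R] (step h0 i w))%:E
   <= (expR ((alpha + c) * mu * h + (alpha + c) ^+ 2 * h / 2 - c * delta))%:E)%E.
Proof.
move=> c0.
apply: (@le_trans _ _ (\int[P]_w (expR ((alpha + c) * step h0 i w) * expR (- (c *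
  delta)))%:E)%E).
  have mS : measurable_fun [set: T] (step_fun h i) by exact: step_fun_measurable.
  apply: ge0_le_integral => //=.
  - apply/measurable_EFinP; apply: measurable_funM.
      by apply: measurableT_comp => //; apply: measurable_funB => //;
        exact: measurable_funM.
    apply: measurableT_comp => //; apply: measurable_indic.
    by rewrite (_ : [set x | _] = `]delta, +oo[%classic)//; apply/seteqP;
      split => x /=; rewrite in_itv/= andbT.
  - apply/measurable_EFinP; apply: measurable_funM => //.
    by apply: measurableT_comp => //; exact: measurable_funM.
  move=> w _; rewrite lee_fin indicE.
  have [Dw|Dw] := ltP delta (step_fun h i w).
    rewrite mem_set// mulr1 -expRD ler_expR (mulrDl alpha) -[leRHS]addrA lerD2l.
    apply: (@le_trans _ _ 0); first by rewrite oppr_le0 mulr_ge0// ltW.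
    by rewrite -mulrBr mulr_ge0// subr_ge0 ltW.
  by rewrite memNset ?mulr0 ?mulr_ge0 ?expR_ge0//=; apply/negP; rewrite -leNgt.
under eq_integral do rewrite EFinM.
rewrite ge0_integralZr//; last first.
  by apply/measurable_EFinP; apply: measurableT_comp => //; exact: measurable_funM.
by rewrite step_mgf -EFinM -expRD.
Qed.

Definition passage_laplace t : \bar R :=
  (\int[P]_w (on_finite (fun z => expR (- (theta * z))) (first_passage X t w))%:E)%E.

Lemma discounted_passage_measurable t : 0 < t ->
  measurable_fun [set: T] (fun w => on_finite (fun z => expR (- (theta * z)))
    (first_passage X t w)).
Proof.
move=> t0; apply: (measurableT_comp (on_finite_measurable _)
  (first_passage_measurable t0)).
apply: measurableT_comp => //; apply: measurableT_comp => //; exact: measurable_funM.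
Qed.

(* With x = n.+1: x^3 steps of length x^-2 cover [0, x], and each step exceeds a
   fixed delta with probability O(exp (- x delta)), so overshoots are negligible. *)
Definition mesh (n : nat) : R := n.+1%:R ^- 2.
Lemma mesh_gt0 n : 0 < mesh n. Proof. by rewrite invr_gt0 exprn_gt0. Qed.
Definition horizon (n : nat) := (n.+1 ^ 3)%N.
Notation grid_step n := (step (mesh_gt0 n)).
Definition discount n i : R := expR (- (i.+1%:R * (theta * mesh n))).
(** Discrete counterpart of exp (- theta Z). The hitting events are disjoint, so at most one term is
    nonzero; a level not reached by time [horizon n * mesh n] = n + 1 contributes 0. *)
Definition grid_discount t n w : R :=
  \sum_(i < horizon n) discount n i * \1_(first_hit (grid_step n) t i) w.

Lemma grid_first_hit_measurable t n i : measurable (first_hit (grid_step n) t i).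
Proof. by apply: first_hit_measurable; exact: step_indep. Qed.

Lemma grid_discount_measurable t n : measurable_fun [set: T] (grid_discount t n).
Proof.
apply: measurable_sum => i; apply: measurable_funM => //; apply: measurable_indic.
exact: grid_first_hit_measurable.
Qed.

Lemma integral_grid_discount t n : (\int[P]_w (grid_discount t n w)%:E =
  \sum_(i < horizon n) (discount n i)%:E * P (first_hit (grid_step n) t i))%E.
Proof.
under eq_integral do rewrite -sumEFin.
rewrite ge0_integral_sum//=.
- apply: eq_bigr => i _; under eq_integral do rewrite EFinM.
  rewrite ge0_integralZl//.
  + by rewrite integral_indic ?setIT//; exact: grid_first_hit_measurable.
  + by apply/measurable_EFinP; apply: measurable_indic;
    exact: grid_first_hit_measurable.
  + by rewrite lee_fin expR_ge0.
- move=> i; apply/measurable_EFinP; apply: measurable_funM => //;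
  apply: measurable_indic.
  exact: grid_first_hit_measurable.
- by move=> i w _; rewrite lee_fin mulr_ge0 ?expR_ge0.
Qed.

Lemma integral_grid_discount_le t n :
  (\int[P]_w (grid_discount t n w)%:E <= (expR (- (alpha * t)))%:E)%E.
Proof.
rewrite integral_grid_discount; apply: first_hit_laplace_le => //.
- exact: step_indep.
- exact/ltW/laplace_exponent_gt0.
- exact: step_mgf1.
Qed.

(** The walk can notice a passage only at a grid time not earlier than the passage itself, so it is
    discounted more. *)
Lemma grid_discount_le_passage t n w : 0 < t ->
  grid_discount t n w <= on_finite (fun z => expR (- (theta * z))) (first_passage X
    t w).
Proof.
move=> t0; apply: sum_first_hit_le => [|i iN [_ /= ti]].
  by apply: on_finite_ge0 => x; exact: expR_ge0.
have m0 := mesh_gt0 n.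
rewrite step_partial_sum in ti.
have g0 : 0 <= i.+1%:R * mesh n by rewrite mulr_ge0// ltW.
have /(first_passage_le t0 (drifted0 w) (@drifted_continuous w) g0) :
  exists2 u, 0 <= u <= i.+1%:R * mesh n & t <= X u w.
  by exists (i.+1%:R * mesh n) => //; rewrite g0 lexx.
have := first_passage_ge0 X t w.
case: (first_passage X t w) => [z| |]//=; rewrite !lee_fin => z0 zi.
by rewrite ler_expR lerN2 mulrCA ler_wpM2l// ltW.
Qed.

Lemma passage_laplace_ge t : 0 < t -> ((expR (- (alpha * t)))%:E <= passage_laplace
  t)%E.
Proof.
move=> t0.
have a0 := laplace_exponent_gt0.
have L0 : (0 <= passage_laplace t)%E.
  by apply: integral_ge0 => w _; rewrite lee_fin on_finite_ge0// => x; exact: expR_ge0.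
case EL : (passage_laplace t) L0 => [L| |]// L0; last by rewrite leey.
rewrite lee_fin in L0.
(* Bounds the exponent in [step_tail] with Chernoff parameter c = x = n + 1 and step length x^-2,
   using alpha + x <= (alpha + 1) x for x >= 1. *)
pose C := expR (((alpha + 1) * `|mu| + (alpha + 1) ^+ 2 / 2)).
have key delta : 0 < delta -> 1 <= expR (alpha * (t + delta)) * L.
  move=> d0.
  (* The first summand comes from x^3 overshoot errors of order exp (- x delta); the second comes
     from the mass surviving up to time x, through exp (- theta x) <= 1 / (theta x). *)
  apply: (@le_of_leDharmonic _ _ _ (expR (alpha * t) * C * (256 / delta ^+ 4) +
    expR (alpha * t) * theta^-1)) => n.
  have x0 : 0 < n.+1%:R :> R by [].
  have x1 : 1 <= n.+1%:R :> R by rewrite ler1n.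
  set x : R := n.+1%:R in x0 x1 *.
  have mE : mesh n = x ^- 2 by [].
  have tail i : (\int[P]_w (expR (alpha * grid_step n i w - theta * mesh n) *
     \1_[set y : R | (delta < y)%R] (grid_step n i w))%:E <= (C * expR (- (x *
       delta)))%:E)%E.
    apply: (le_trans (step_tail (mesh_gt0 n) i delta (ltW x0))).
    rewrite lee_fin -expRD ler_expR lerD2r.
    have ax : alpha + x <= (alpha + 1) * x by rewrite mulrDl mul1r lerD2r
      ler_peMr// ltW.
    have ax0 : 0 <= alpha + x by rewrite addr_ge0// ltW.
    have xi0 : 0 <= x ^- 2 by rewrite invr_ge0 exprn_ge0// ltW.
    have a10 : 0 <= alpha + 1 by rewrite addr_ge0// ltW.
    rewrite mE; apply: lerD.
      apply: (@le_trans _ _ ((alpha + x) * `|mu| * x ^- 2)).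
        by apply: ler_wpM2r; [exact: xi0|apply: ler_wpM2l => //; exact: ler_norm].
      rewrite ler_pdivrMr ?exprn_gt0// mulrAC ler_wpM2r//.
      apply: (le_trans ax); apply: ler_wpM2l => //.
      by rewrite expr2 ler_peMr// ltW.
    apply: ler_wpM2r; first by rewrite invr_ge0.
    by rewrite ler_pdivrMr ?exprn_gt0// -exprMn lerXn2r ?nnegrE// mulr_ge0// ltW.
  have := @first_hit_laplace_ge _ _ _ P (grid_step n) (step_indep (mesh_gt0 n))
    alpha (theta * mesh n)
     (ltW a0) (mulr_ge0 (ltW theta0) (ltW (mesh_gt0 n))) (step_mgf1 (mesh_gt0 n)) t
       delta _ (horizon n) t0
     (mulr_ge0 (expR_ge0 _) (expR_ge0 _)) tail.
  rewrite -integral_grid_discount => H.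
  have {}H : (1 <= (expR (alpha * (t + delta)))%:E * L%:E +
     ((horizon n)%:R * (expR (alpha * t) * (C * expR (- (x * delta)))) +
       expR (alpha * t - (horizon n)%:R * (theta * mesh n)))%:E)%E.
    apply: (le_trans H); apply: leeD => //; apply: lee_wpmul2l;
      first by rewrite lee_fin expR_ge0.
    rewrite -EL; apply: ge0_le_integral => //=.
    - by move=> w _; rewrite lee_fin; apply: sumr_ge0 => i _;
      rewrite mulr_ge0 ?expR_ge0.
    - by apply/measurable_EFinP; exact: grid_discount_measurable.
    - by apply/measurable_EFinP; exact: discounted_passage_measurable.
    - by move=> w _; rewrite lee_fin grid_discount_le_passage.
  move: H; rewrite -EFinM -EFinD lee_fin => /le_trans; apply.
  rewrite lerD2l [leRHS]mulrDl; apply: lerD.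
    rewrite (_ : (horizon n)%:R = x ^+ 3); last by rewrite /horizon natrX.
    rewrite [leLHS](_ : _ = expR (alpha * t) * C * (x ^+ 3 * expR (- (x *
      delta)))); last by ring.
    rewrite -[leRHS]mulrA ler_wpM2l ?mulr_ge0 ?expR_ge0//.
    apply: (le_trans (expR_cube_le x0 d0)).
    by rewrite invfM mulrA.
  rewrite (_ : (horizon n)%:R * (theta * mesh n) = x * theta); last first.
    by rewrite /horizon natrX mE -/x; field; rewrite gt_eqF.
  rewrite expRD -mulrA ler_wpM2l ?expR_ge0//.
  by rewrite -invfM expR_neg_le.
(* The mesh is gone; now the overshoot allowance [delta] = 1 / (n + 1) tends to 0, with exp (- alpha
   delta) >= 1 - alpha delta. *)
rewrite lee_fin; apply: (@le_of_leDharmonic _ _ _ (alpha * expR (- (alpha * t)))) => n.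
set delta : R := n.+1%:R^-1; have d0 : 0 < delta by rewrite invr_gt0.
have := key delta d0.
rewrite mulrDr expRD -mulrA -ler_pdivrMl ?expR_gt0// mulr1 -expRN => H.
have H1 : expR (- (alpha * delta)) * expR (- (alpha * t)) <= L.
  by rewrite expRN ler_pdivrMl ?expR_gt0.
have H2 : (1 - alpha * delta) * expR (- (alpha * t)) <= L.
  by apply: le_trans H1; rewrite ler_wpM2r ?expR_ge0// expR_ge1Dx.
by move: H2; rewrite mulrBl mul1r lerBlDr (mulrAC alpha).
Qed.

(* A path may touch [t] without any grid point noticing, whence the level
   [t - eps]. *)
Lemma passage_le_grid_discount (t eps eta : R) w : 0 < t -> 0 < eps -> 0 < eta ->
  exists m, forall n, (m <= n)%N ->
   expR (- (theta * eta)) * on_finite (fun z => expR (- (theta * z)))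
     (first_passage X t w)
   <= grid_discount (t - eps) n w.
Proof.
move=> t0 e0 eta0.
have gd0 n : 0 <= grid_discount (t - eps) n w.
  by apply: sumr_ge0 => i _; rewrite mulr_ge0 ?expR_ge0.
have := first_passage_ge0 X t w.
case EZ : (first_passage X t w) => [z| |]//=; last by exists 0%N => n _; rewrite mulr0.
rewrite lee_fin => z0.
have [u /andP[u0 uz] tu] : exists2 u, 0 <= u <= z & t <= X u w.
  by apply/(first_passage_le t0 (drifted0 w) (@drifted_continuous w) z0); rewrite EZ.
have [rho rho0 Hrho] := path_near (@drifted_continuous w) u0 e0.
(* A mesh below [rho] keeps the path within [eps] of its value at [u] until the next grid time; a
   mesh below [eta] bounds the delay in the discount. *)
pose b := Num.min rho eta.
have b0 : 0 < b by rewrite lt_min rho0 eta0.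
(* The first bound gives [mesh n < b]; the second puts [u] before the time horizon n + 1. *)
exists (maxn (Num.truncn b^-1) (Num.truncn (u + 1))) => n.
rewrite geq_max => /andP[nb nu].
have x0 : 0 < n.+1%:R :> R by [].
have x1 : 1 <= n.+1%:R :> R by rewrite ler1n.
have bx : b^-1 < n.+1%:R.
  by apply: lt_le_trans (Num.Theory.truncnS_gt _) _; rewrite ler_nat.
have ux : u + 1 < n.+1%:R.
  by apply: lt_le_trans (Num.Theory.truncnS_gt _) _; rewrite ler_nat.
have hx : mesh n <= n.+1%:R^-1.
  by rewrite /mesh lef_pV2 ?posrE ?exprn_gt0// expr2 ler_peMr// ltW.
have hb : mesh n < b.
  by apply: (le_lt_trans hx); rewrite invf_plt ?posrE.
have h0 := mesh_gt0 n.
(* [j] is the last grid index at or before [u], so the walk is above [t - eps] at index [j.+1] and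
   its first hit has index at most [j]. *)
pose j := Num.truncn (u / mesh n).
have /andP[j1 j2] := Num.Theory.truncn_itv (divr_ge0 u0 (ltW h0)).
rewrite -/j in j1 j2.
have {}j1 : j%:R * mesh n <= u by rewrite -ler_pdivlMr.
have {}j2 : u < j.+1%:R * mesh n by rewrite -ltr_pdivrMr.
have j3 : j.+1%:R * mesh n <= u + mesh n by rewrite -natr1 mulrDl mul1r lerD2r.
have Xj : t - eps <= partial_sum (grid_step n) j.+1 w.
  rewrite step_partial_sum.
  have j4 : `|j.+1%:R * mesh n - u| < rho.
    rewrite gtr0_norm ?subr_gt0// ltrBlDl (le_lt_trans j3)// ltrD2l (lt_le_trans hb)//.
    by rewrite ge_min lexx.
  have jh0 : 0 <= j.+1%:R * mesh n by rewrite mulr_ge0// ltW.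
  have := Hrho _ jh0 j4.
  rewrite ltr_distl => /andP[+ _] => /ltW; apply: le_trans.
  by rewrite lerD2r.
have [i ij hi] := first_hit_exists Xj.
have iN : (i < horizon n)%N.
  rewrite -(ltr_nat R) /horizon natrX.
  apply: (@le_lt_trans _ _ j%:R); first by rewrite ler_nat.
  rewrite -(ltr_pM2r h0) (le_lt_trans j1)// /mesh exprSr mulrAC mulfV ?mul1r.
    by apply: lt_trans ux; rewrite ltrDl.
  by rewrite gt_eqF// exprn_gt0.
apply: (le_trans _ (@le_sum_first_hit _ _ _ (grid_step n) (t - eps) (horizon n)
  (discount n) i w _ iN hi)); last first.
  by move=> l; exact: expR_ge0.
rewrite -expRD ler_expR -opprD lerN2 -mulrDr mulrCA ler_wpM2l ?(ltW theta0)//.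
apply: (@le_trans _ _ (j.+1%:R * mesh n)); first by rewrite ler_wpM2r ?(ltW h0)//
  ler_nat ltnS.
rewrite (le_trans j3)// addrC lerD// (le_trans (ltW hb))//.
by rewrite ge_min lexx orbT.
Qed.

(** Fatou along the grids: for every path the walk eventually notices the lowered level [t - eps]
    with delay at most [eps], and [integral_grid_discount_le] is uniform in the mesh. Then [eps]
    tends to 0. *)
Lemma passage_laplace_le t : 0 < t -> (passage_laplace t <= (expR (- (alpha *
  t)))%:E)%E.
Proof.
move=> t0; have a0 := laplace_exponent_gt0.
have L0 : (0 <= passage_laplace t)%E.
  by apply: integral_ge0 => w _; rewrite lee_fin on_finite_ge0// => x; exact: expR_ge0.
(* The grid bound holds at every level, so [eps] may exceed [t]; the value 1 is used below for
   finiteness. *)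
have key eps : 0 < eps ->
    ((expR (- (theta * eps)))%:E * passage_laplace t <= (expR (- (alpha * (t -
      eps))))%:E)%E.
  move=> e0; rewrite -ge0_integralZl//; last 2 first.
  - by apply/measurable_EFinP; exact: discounted_passage_measurable.
  - by move=> w _; rewrite lee_fin on_finite_ge0// => x; exact: expR_ge0.
  apply: (@le_trans _ _ (\int[P]_w limn_einf (fun n => (grid_discount (t - eps) n
    w)%:E))%E).
    apply: ge0_le_integral => //=.
    - by move=> w _; rewrite mule_ge0// lee_fin ?expR_ge0// on_finite_ge0// => x;
      exact: expR_ge0.
    - apply/measurable_EFinP; apply: measurable_funM => //;
      exact: discounted_passage_measurable.
    - rewrite /limn_einf; apply: measurableT_comp => //;
      apply: measurable_fun_limn_esup => n.
      by apply: measurableT_comp => //; apply/measurable_EFinP;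
        exact: grid_discount_measurable.
    - move=> w _; have [m Hm] := passage_le_grid_discount w t0 e0 e0.
      by apply: (@limn_einf_ge _ _ _ m) => n /Hm; rewrite -EFinM lee_fin.
  apply: (le_trans (fatou _ _ _ _)) => //.
  - by move=> n; apply/measurable_EFinP; exact: grid_discount_measurable.
  - by move=> n w _; rewrite lee_fin; apply: sumr_ge0 => i _;
    rewrite mulr_ge0 ?expR_ge0.
  - by apply: limn_einf_le => n; exact: integral_grid_discount_le.
have fin : passage_laplace t \is a fin_num.
  rewrite ge0_fin_numE//; have := key 1 ltr01.
  case: (passage_laplace t) L0 => [r| |]//; rewrite ?ltry//.
  by rewrite gt0_muley ?lte_fin ?expR_gt0.
move: L0 key fin; rewrite /passage_laplace; case: (\int[P]_w _)%E => [L| |]// L0 key _.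
rewrite lee_fin in L0; rewrite lee_fin.
apply: (@le_of_leDharmonic _ _ _ ((alpha + theta) * L)) => n.
set eps : R := n.+1%:R^-1; have e0 : 0 < eps by rewrite invr_gt0.
have := key eps e0; rewrite -EFinM lee_fin => H.
have {}H : L * expR (- (theta * eps + alpha * eps)) <= expR (- (alpha * t)).
  rewrite opprD expRD mulrA [L * _]mulrC.
  rewrite (_ : - (alpha * t) = - (alpha * (t - eps)) + - (alpha * eps)); last by ring.
  by rewrite expRD; apply: ler_wpM2r; rewrite ?expR_ge0.
have : L * (1 - (theta * eps + alpha * eps)) <= expR (- (alpha * t)).
  by apply: le_trans H; rewrite ler_wpM2l// expR_ge1Dx.
rewrite mulrBr mulr1 lerBlDr => /le_trans; apply.
by rewrite (_ : L * _ = (alpha + theta) * L * eps)//; ring.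
Qed.
End brownian_passage.

(** * Law of the counting process *)

Section counting_law.
Context d (T : measurableType d) (R : realType) (P : probability T R).
Variables (k : nat) (lambda : nat -> R) (M : R -> T -> nat).
Hypothesis M_gcp : generalized_counting_process P k lambda M.

Definition pmf n s : R := fine (P [set w | M s w = n]).

Lemma count0 w : M 0 w = 0%N.
Proof.
by have [_ [_ count0 _ _ _] _] := M_gcp; apply/eqP; rewrite -(eqr_nat R) count0.
Qed.

Lemma M_event_measurable s (A : set nat) : 0 <= s -> measurable [set w | A (M s w)].
Proof.
have [mM _ _] := M_gcp; move=> s0.
by have := mM s s0 measurableT A I; rewrite setTI.
Qed.

Notation Mr := (fun t w => (M t w)%:R : R).

Lemma pmfE n s : 0 <= s -> P [set w | M s w = n] = (pmf n s)%:E.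
Proof. by move=> s0; rewrite fineK// fin_num_measure//;
  exact: (@M_event_measurable s [set n]). Qed.

Lemma pmf_ge0 n s : 0 <= pmf n s. Proof. exact/fine_ge0/measure_ge0. Qed.

Lemma pmf_le1 n s : 0 <= s -> pmf n s <= 1.
Proof.
move=> s0; rewrite -lee_fin -pmfE//; apply: probability_le1.
exact: (@M_event_measurable s [set n]).
Qed.

Lemma increment_natE s u j : [set w | Mr u w - Mr s w = j%:R] = [set w | M u w = (M
  s w + j)%N].
Proof.
apply/seteqP; split => w /=.
  move=> /eqP; rewrite subr_eq -natrD eqr_nat => /eqP ->; by rewrite addnC.
by move=> ->; rewrite natrD addrAC subrr add0r.
Qed.

Lemma increment_measurable_nat s u : 0 <= s -> 0 <= u -> forall A : set R,
  measurable (increment Mr s u @^-1` A).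
Proof.
have [mM _ _] := M_gcp; move=> s0 u0 A.
pose f w := (M s w, M u w).
have mf : measurable_fun setT f by apply: measurable_fun_pair; exact: mM.
rewrite (_ : _ @^-1` _ = f @^-1` [set p | A (p.2%:R - p.1%:R)])//.
rewrite -[X in measurable X]setTI; apply: mf => //.
rewrite (_ : [set p | _] = \bigcup_(i in setT) ([set i] `*` [set j | A (j%:R - i%:R)])).
  by apply: bigcupT_measurable => i; apply: measurableX.
apply/seteqP; split => [[i j] /= Aij|[i j] [i' _ [/= -> ]]//].
by exists i.
Qed.

(** Monotone paths are not part of the definition; up to a null set they follow from stationarity,
    since the increment has the law of M(h) - M(0) = M(h) >= 0. *)
Lemma increment_nonneg s h : 0 <= s -> 0 <= h ->
  P [set w | (M (s + h) w < M s w)%N] = 0%E.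
Proof.
have [mM [_ _ _ stat _] _] := M_gcp; move=> s0 h0.
transitivity (P (increment Mr s (s + h) @^-1` `]-oo, 0[%classic)).
  congr (P _); apply/seteqP; split => w; rewrite /increment /= in_itv/= subr_lt0
    ltr_nat//.
rewrite stat//; rewrite (_ : _ @^-1` _ = set0) ?measure0//; apply/seteqP;
  split => w //=.
by rewrite /increment /= in_itv/= count0 subr0 ltNge ler0n.
Qed.

Lemma pmf_conv n s h : 0 <= s -> 0 <= h ->
  pmf n (s + h) = \sum_(j < n.+1) pmf (n - j) s * pmf j h.
Proof.
move=> s0 h0; have [mM [_ M0' ind stat _] _] := M_gcp.
have sh0 : 0 <= s + h by rewrite addr_ge0.
pose F j := [set w | M (s + h) w = n] `&` [set w | (M s w + j)%N = n].
have mn : measurable [set w | M (s + h) w = n] by exact: (@M_event_measurable _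
  [set n]).
have mF j : measurable (F j).
  apply: measurableI => //; exact: (@M_event_measurable s [set m | (m + j)%N = n]).
have tF : trivIset setT F.
  apply/trivIsetP => i j _ _ ij; apply/seteqP; split => w //= [[_ h1] [_ h2]].
  by move/eqP: ij; apply; apply: (@addnI (M s w)); rewrite h1 h2.
(* The null event of a decrease is added to both sides; off it, M(s + h) = n forces M(s) <= n, so
   finitely many increments suffice. *)
have E1 : P [set w | M (s + h) w = n] = P (\big[setU/set0]_(j < n.+1) F j).
  rewrite -[RHS]adde0 -(increment_nonneg s0 h0).
  rewrite -measureU//; last 3 first.
  - by apply: bigsetU_measurable.
  - have := increment_measurable_nat s0 sh0 `]-oo, 0[%classic.
    congr measurable; apply/seteqP; split => w; rewrite /increment /= in_itv/=
      subr_lt0 ltr_nat//.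
  - apply/seteqP; split => w //= []; rewrite -bigcup_mkord => -[j _ [/= h1 h2]].
    by rewrite h1 -h2 ltnNge leq_addr.
  rewrite -(measureU0 _ _ (increment_nonneg s0 h0)).
  - congr (P _); apply/seteqP; split => w /=.
      move=> [Mn|]; last by right.
      have [sn|] := leqP (M s w) n; last by rewrite -Mn; right.
      left; rewrite -bigcup_mkord; exists (n - M s w)%N;
        first by rewrite /= ltnS leq_subr.
      by split => //=; rewrite subnKC.
    move=> [|]; last by right.
    by rewrite -bigcup_mkord => -[j _ [/= h1 h2]]; left.
  - exact: mn.
  - have := increment_measurable_nat s0 sh0 `]-oo, 0[%classic.
    congr measurable; apply/seteqP; split => w; rewrite /increment /= in_itv/=
      subr_lt0 ltr_nat//.
have E2 j : (j <= n)%N -> P (F j) = (pmf (n - j) s * pmf j h)%:E.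
  move=> jn.
  (* Two increments, over [0, s] and [s, s + h]; the first is M(s) because M(0) = 0. *)
  pose tt i := nth 0 [:: 0; s; s + h] i.
  pose A i : set R := if i is 0%N then [set (n - j)%:R] else [set j%:R].
  have := ind 2%N tt A; rewrite /tt /= => /(_ (lexx 0)) H.
  have {}H : P (\bigcap_(i < 2) (increment Mr (tt i) (tt i.+1) @^-1` A i)) =
    (P (increment Mr 0 s @^-1` A 0%N) * P (increment Mr s (s + h) @^-1` A 1%N))%E.
    rewrite H ?big_ord_recr ?big_ord0 /= ?mul1e//.
    - by move=> [|[|]]//= _; rewrite lerDl.
    - by move=> [|i] _ /=; exact: measurable_set1.
  have Ei u m : 0 <= u -> P (increment Mr 0 u @^-1` [set m%:R]) = (pmf m u)%:E.
    move=> u0; rewrite -pmfE//; congr (P _).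
    have := increment_natE 0 u m; rewrite /increment /preimage /= => ->.
    by apply/seteqP; split => w /=; rewrite count0.
  rewrite EFinM -!Ei// -(stat s h)//; rewrite /A in H; rewrite -H.
  congr (P _); apply/seteqP; split => w.
    move=> [/= h1 h2] i; case: i => [_|[_|//]] /=; rewrite /increment/=.
      by rewrite count0 subr0 -h2 addnK.
    by rewrite h1 -{1}h2 natrD addrAC subrr add0r.
  move=> Hw; have /= := Hw 0%N isT; have /= := Hw 1%N isT.
  rewrite /increment /= count0 subr0 => /eqP; rewrite subr_eq -natrD eqr_nat => /eqP Mj.
  move=> /eqP; rewrite eqr_nat => /eqP Ms.
  split => /=; first by rewrite Mj Ms subnKC.
  by rewrite Ms subnK.
rewrite {1}/pmf E1 measure_bigsetU//.
rewrite (eq_bigr (fun j : 'I_n.+1 => (pmf (n - j) s * pmf j h)%:E)); last first.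
  by move=> j _; apply: E2; rewrite -ltnS.
by rewrite sumEFin.
Qed.

(** The generator of the process, indexed by jump size; size 0 carries the total exit rate with a
    minus sign. *)
Definition jump_rate j : R :=
  if j == 0%N then - total_rate k lambda else if (j <= k)%N then lambda j else 0.

(** The transition rates are read only at time 0 in state 0, an event of probability 1, where
    conditioning is trivial. [pmf_conv] carries them to later times, so positivity of Pr{M(t) = n}
    is never an issue. *)
Lemma pmf_rate j : (pmf j h - (j == 0%N)%:R) / h @[h --> 0^'+] --> jump_rate j.
Proof.
have [_ _ tr] := M_gcp.
have P0 : P [set w | M 0 w = 0%N] = 1%E.
  by rewrite (_ : [set _ | _] = setT) ?probability_setT//; apply/seteqP;
    split => w //= _; exact: count0.
have trE h i : transition P M 0 0 i h = pmf i h.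
  rewrite /transition /cond_prob P0 /= divr1 /pmf add0r add0n; congr (fine (P _)).
  by apply/seteqP; split => w /= => [[]//|->]; rewrite count0.
have [|o0 oj ok] := tr 0 0%N (lexx 0); first by rewrite P0 lte01.
have lim (f : R -> R) c b : (fun h => f h - (b + c * h)) =o_ (0^'+) id ->
    (f h - b) / h @[h --> 0^'+] --> c.
  move/eqoP => fo; apply/cvgrPdist_le => /= e e0.
  have := fo e e0; apply: filterS2 (nbhs_right_gt 0) => h h0.
  rewrite (gtr0_norm h0) -ler_pdivrMr// => H; apply: le_trans H.
  rewrite ler_pdivlMr// -[X in _ * X <= _](gtr0_norm h0) -normrM distrC.
  rewrite le_eqVlt; apply/orP; left; apply/eqP; congr (`|_|).
  by field; rewrite gt_eqF.
rewrite /jump_rate; case: eqP => [->|/eqP j0].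
  apply: lim; rewrite (_ : (fun h => _) = (fun h => transition P M 0 0 0 h - (1 -
    total_rate k lambda * h)))//.
  by apply/funext => h; rewrite trE mulNr.
apply: lim; case: leqP => jk.
  rewrite (_ : (fun h => _) = (fun h => transition P M 0 0 j h - lambda j * h)).
    by apply: oj; rewrite lt0n j0.
  by apply/funext => h; rewrite trE add0r.
rewrite (_ : (fun h => _) = transition P M 0 0 j); first exact: ok.
by apply/funext => h; rewrite trE mul0r addr0 subr0.
Qed.

Lemma pmf_cvg j : pmf j h - (j == 0%N)%:R @[h --> 0^'+] --> (0 : R).
Proof.
suff : pmf j h - (j == 0%N)%:R @[h --> 0^'+] --> 0 * jump_rate j by rewrite mul0r.
have H : h * ((pmf j h - (j == 0%N)%:R) / h) @[h --> 0^'+] --> 0 * jump_rate j.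
  apply: cvgM; last exact: pmf_rate.
  by apply: cvg_at_right_filter; exact: cvg_id.
apply: cvg_trans H; apply: near_eq_cvg.
near=> h; rewrite mulrC divfK// gt_eqF//; near: h; exact: nbhs_right_gt.
Unshelve. all: by end_near. Qed.

Lemma pmf_delta n s h : 0 <= s -> 0 <= h -> pmf n (s + h) - pmf n s =
  \sum_(j < n.+1) pmf (n - j) s * (pmf j h - (j == 0%N :> nat)%:R).
Proof.
move=> s0 h0; rewrite pmf_conv//.
under [RHS]eq_bigr do rewrite mulrBr.
rewrite sumrB; congr (_ - _).
rewrite big_ord_recl /= subn0 mulr1 big1 ?addr0// => i _.
by rewrite mulr0.
Qed.

(** Prepares the left derivative, whose difference quotient has coefficients at the moving time
    [s - h]. By [pmf_delta] the change is at most the sum of |pmf j h - delta_{j0}|, which tends to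
    0. *)
Lemma pmf_left_cvg n s : 0 < s -> pmf n (s - h) @[h --> 0^'+] --> pmf n s.
Proof.
move=> s0.
have H : \sum_(j < n.+1) `|pmf j h - (j == 0%N :> nat)%:R| @[h --> 0^'+] --> (0 : R).
  suff : \sum_(j < n.+1) `|pmf j h - (j == 0%N :> nat)%:R| @[h --> 0^'+] -->
    \sum_(j < n.+1) `|0 : R|.
    by rewrite [X in _ --> X -> _]big1// => *; rewrite normr0.
  apply: (@cvg_finsum _ _ _ n.+1 (fun j h => `|pmf j h - (j == 0%N :> nat)%:R|)
    (fun=> `|0|)) => i.
  by apply: cvg_norm; exact: pmf_cvg.
apply/cvgrPdist_le => /= e e0.
have /cvgrPdist_le /(_ e e0) := H.
move=> He; near=> h.
have h0 : 0 < h by near: h; exact: nbhs_right_gt.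
have sh : 0 <= s - h by rewrite subr_ge0; near: h; exact: nbhs_right_le.
have : `|0 - \sum_(j < n.+1) `|pmf j h - (j == 0%N :> nat)%:R| | <= e by near: h;
  exact: He.
rewrite sub0r normrN ger0_norm ?sumr_ge0//; apply: le_trans.
rewrite -[in X in `|X - _|](subrK h s) pmf_delta ?(ltW h0)//.
apply: (le_trans (ler_norm_sum _ _ _)); apply: ler_sum => j _.
by rewrite normrM ger0_norm ?pmf_ge0// ler_piMl// pmf_le1.
Unshelve. all: by end_near. Qed.

(** Kolmogorov's forward equations. The right derivative comes directly from [pmf_delta] at [s], the
    left one from [pmf_delta] at [s - h]. *)
Lemma pmf_is_derive n (s : R) : 0 < s ->
  is_derive s 1 (pmf n) (\sum_(j < n.+1) pmf (n - j) s * jump_rate j).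
Proof.
move=> s0.
have : h^-1 *: (pmf n (h + s) - pmf n s) @[h --> 0^'] --> \sum_(j < n.+1) pmf (n -
  j) s * jump_rate j.
  apply: (@cvg_at_right_left_dnbhs _ R^o).
    have H : \sum_(j < n.+1) pmf (n - j) s * ((pmf j h - (j == 0%N :> nat)%:R) / h)
      @[h --> 0^'+]
      --> \sum_(j < n.+1) pmf (n - j) s * jump_rate j.
      apply: (@cvg_finsum _ _ _ n.+1 (fun j h => pmf (n - j) s * ((pmf j h - (j ==
        0%N :> nat)%:R) / h))
        (fun j => pmf (n - j) s * jump_rate j)) => j.
      by apply: cvgM; [exact: cvg_cst|exact: pmf_rate].
    apply: cvg_trans H; apply: near_eq_cvg.
    near=> h; have h0 : 0 < h by near: h; exact: nbhs_right_gt.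
    rewrite [h + s]addrC pmf_delta ?(ltW h0) ?(ltW s0)// /GRing.scale /= mulr_sumr.
    by apply: eq_bigr => j _; rewrite mulrA mulrC.
  apply/cvg_at_leftNP; rewrite oppr0.
  have H : \sum_(j < n.+1) pmf (n - j) (s - h) * ((pmf j h - (j == 0%N :> nat)%:R)
    / h) @[h --> 0^'+]
      --> \sum_(j < n.+1) pmf (n - j) s * jump_rate j.
    apply: (@cvg_finsum _ _ _ n.+1 (fun j h => pmf (n - j) (s - h) * ((pmf j h - (j
      == 0%N :> nat)%:R) / h))
        (fun j => pmf (n - j) s * jump_rate j)) => j.
    by apply: cvgM; [exact: pmf_left_cvg|exact: pmf_rate].
  apply: cvg_trans H; apply: near_eq_cvg.
  near=> h; have h0 : 0 < h by near: h; exact: nbhs_right_gt.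
  have sh : 0 <= s - h by rewrite subr_ge0; near: h; exact: nbhs_right_le.
  have E : pmf n (- h + s) - pmf n s =
      - \sum_(j < n.+1) pmf (n - j) (s - h) * (pmf j h - (j == 0%N :> nat)%:R).
    by rewrite -pmf_delta ?(ltW h0)// subrK opprB addrC [- h + s]addrC addrC.
  rewrite /= E /GRing.scale /= invrN mulrNN mulr_sumr.
  by apply: eq_bigr => j _; rewrite mulrA mulrC.
move=> H; apply: DeriveDef.
  by apply/cvg_ex; eexists; under eq_fun do rewrite /= scaler1; exact: H.
rewrite /derive; apply/cvg_lim => //; under eq_fun do rewrite /= scaler1; exact: H.
Unshelve. all: by end_near. Qed.

Lemma jump_rate_sum n s : \sum_(j < n.+1) pmf (n - j) s * jump_rate j =
  - total_rate k lambda * pmf n s + \sum_(1 <= j < (minn n k).+1) lambda j * pmf (n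
    - j) s.
Proof.
rewrite big_ord_recl /= subn0 mulrC; congr (_ + _).
rewrite big_add1 /= big_mkord /bump /=.
rewrite -(big_mkord xpredT (fun i => pmf (n - i.+1) s * jump_rate i.+1)).
rewrite (big_cat_nat _ (geq_minl n k))//= [X in _ + X]big1_seq ?addr0 => [|j].
  rewrite big_mkord; apply: eq_bigr => j _.
  by rewrite /jump_rate /= (leq_trans (ltn_ord j) (geq_minr _ _)) mulrC.
rewrite mem_index_iota => /andP[_ /andP[]].
rewrite geq_min leqNgt => /orP[/negbTE -> //|kj _].
by rewrite /jump_rate /= ltnNge kj mulr0.
Qed.

Notation Lam := (total_rate k lambda).

Lemma pmf_expR_is_derive n (s : R) : 0 < s ->
  is_derive s 1 (fun s => pmf n s * expR (Lam * s))
    (\sum_(1 <= j < (minn n k).+1) lambda j * (pmf (n - j) s * expR (Lam * s))).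
Proof.
move=> s0; have H1 := pmf_is_derive n s0; have H2 := is_derive_expRM Lam s.
apply: (is_derive_eq (is_deriveM H1 H2)).
rewrite jump_rate_sum /GRing.scale /= mulrDr mulrA.
under [RHS]eq_bigr do rewrite mulrA mulrC.
rewrite -mulr_sumr; ring.
Qed.

(** The integrating factor exp (Lambda s) removes the diagonal term, so the derivative involves only
    smaller states: by strong induction it is a polynomial, and integration adds a constant. *)
Lemma pmf_poly n : exists Q : {poly R}, forall s, 0 < s ->
  pmf n s * expR (Lam * s) = Q.[s].
Proof.
elim/ltn_ind: n => n IH.
(* Choice needs a family over all of [nat]; the value 0 at indices from [n] on is a mere default. *)
have /boolp.choice[Q HQ] : forall m, exists Qm : {poly R}, (m < n)%N ->
    forall s, 0 < s -> pmf m s * expR (Lam * s) = Qm.[s].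
  move=> m; have [/IH [Qm HQm]|nm] := ltnP m n; first by exists Qm.
  by exists 0.
have [A HA] := poly_antiderivative (\sum_(1 <= j < (minn n k).+1) lambda j *: Q (n
  - j)%N).
have [c Hc] : exists c, forall s, 0 < s -> pmf n s * expR (Lam * s) - A.[s] = c.
  apply: is_derive0_pos_cst => s s0.
  apply: (is_derive_eq (is_deriveB (pmf_expR_is_derive n s0) (is_derive_poly A s))).
  rewrite HA horner_sum -sumrB big_nat big1// => j /andP[j1 jnk].
  rewrite hornerZ -HQ ?subrr// ltn_subrL j1 /=.
  by move: jnk; rewrite ltnS leq_min => /andP[/(leq_trans j1)].
by exists (A + c%:P) => s s0; rewrite hornerD hornerC -(Hc s s0) addrC subrK.
Qed.

(** The forward equations pass from functions on s > 0 to the polynomials themselves, since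
    agreement at infinitely many points is equality. *)
Lemma pmf_polys : exists Q : nat -> {poly R},
  (forall n s, 0 < s -> pmf n s = (Q n).[s] * expR (- (Lam * s))) /\
  (forall n, (Q n)^`() = \sum_(1 <= j < (minn n k).+1) lambda j *: Q (n - j)%N).
Proof.
have [Q HQ] := boolp.choice pmf_poly.
exists Q; split => [n s s0|n]; first by rewrite -HQ// -mulrA -expRD subrr expR0 mulr1.
apply: poly_eq_pos => s s0; rewrite horner_sum.
have H1 := is_derive_poly (Q n) s.
have H2 := pmf_expR_is_derive n s0.
rewrite -(@derive_val _ _ _ _ _ _ _ H1).
transitivity ('D_1 (fun s => pmf n s * expR (Lam * s)) s).
  apply: near_eq_derive.
  by near=> x; rewrite HQ//; near: x; exact: lt_nbhsr.
rewrite (@derive_val _ _ _ _ _ _ _ H2).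
by apply: eq_bigr => j _; rewrite hornerZ HQ.
Unshelve. all: by end_near. Qed.
End counting_law.

(** * Exponentially damped moments of the passage time *)

Section moments.
Context (R : realType) (mu : R).

Definition rad (theta : R) : R := Num.sqrt (mu ^+ 2 + 2 * theta).

(* [moment i theta t] is the value of E[Z^i exp (- theta Z)] for the passage time
   [Z] of level [t]; the recursion is that of the reverse Bessel polynomials. *)
Fixpoint moment_pair (theta t : R) (i : nat) : R * R :=
  if i is j.+1 then
    let p := moment_pair theta t j in
    (p.2, ((2 * j + 1)%:R * p.2 + t ^+ 2 * p.1) / rad theta ^+ 2)
  else (expR (- ((rad theta - mu) * t)), t / rad theta * expR (- ((rad theta - mu)
    * t))).

Definition moment i theta t := (moment_pair theta t i).1.

Let scaleRE (a b : R) : a *: b = a * b. Proof. by []. Qed.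

Lemma moment0 theta t : moment 0 theta t = expR (- ((rad theta - mu) * t)).
Proof. by []. Qed.
Lemma moment1 theta t : moment 1 theta t = t / rad theta * moment 0 theta t.
Proof. by []. Qed.
Lemma momentSS i theta t : moment i.+2 theta t =
  ((2 * i + 1)%:R * moment i.+1 theta t + t ^+ 2 * moment i theta t) / rad theta ^+ 2.
Proof. by []. Qed.

Lemma rad_gt0 theta : 0 < theta -> 0 < rad theta.
Proof. by move=> h; rewrite sqrtr_gt0 ltr_wpDl ?sqr_ge0// mulr_gt0. Qed.

Lemma rad_sqr theta : 0 < theta -> rad theta ^+ 2 = mu ^+ 2 + 2 * theta.
Proof. by move=> h; rewrite sqr_sqrtr// addr_ge0 ?sqr_ge0// mulr_ge0// ltW. Qed.

Lemma rad_is_derive (theta : R) : 0 < theta -> is_derive theta 1 rad (rad theta)^-1.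
Proof.
move=> h; have r0 := rad_gt0 h.
have H1 : is_derive theta 1 (fun x : R => mu ^+ 2 + 2 * x) 2.
  apply: (is_derive_eq (is_deriveD (is_derive_cst (mu ^+ 2) theta 1) (is_deriveZ 2
    (is_derive_id theta 1)))).
  by rewrite /GRing.scale /= mulr1 add0r.
have p0 : 0 < mu ^+ 2 + 2 * theta by rewrite ltr_wpDl ?sqr_ge0// mulr_gt0.
have H : is_derive theta 1 rad ((2 * rad theta)^-1 * 2) .
  exact: (@is_derive1_comp R Num.sqrt (fun x => mu ^+ 2 + 2 * x) theta _ 2
    (is_derive1_sqrt p0) H1).
by apply: (is_derive_eq H); field; rewrite gt_eqF.
Qed.

(** The shape of [momentSS], differentiated once for both uses: in theta, where [D] = t^2 is
    constant, and in t, where [V] = rad^-2 is constant. *)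
Lemma is_derive_recurrence (f g D V : R -> R) (c x df dg dD dV : R) :
  is_derive x 1 f df -> is_derive x 1 g dg -> is_derive x 1 D dD ->
    is_derive x 1 V dV ->
  is_derive x 1 (fun y => (c * g y + D y * f y) * V y)
    ((c * dg + (dD * f x + D x * df)) * V x + (c * g x + D x * f x) * dV).
Proof.
move=> Hf Hg HD HV.
apply: (is_derive_eq (is_deriveM (is_deriveD (is_deriveZ c Hg) (is_deriveM HD Hf)) HV)).
transitivity ((c * g x + D x * f x) * dV + V x * (c * dg + (D x * df + f x * dD)));
  first by [].
ring.
Qed.

(** Two consecutive indices are carried through the induction because the recursion has depth
    two. *)
Lemma moment_is_derive_theta i (theta t : R) : 0 < theta ->
  is_derive theta 1 (fun x => moment i x t) (- moment i.+1 theta t).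
Proof.
move=> h; have r0 := rad_gt0 h; have Hr := rad_is_derive h.
have rn0 : rad theta != 0 by rewrite gt_eqF.
have HV := is_deriveV rn0 Hr.
have H0 : is_derive theta 1 (fun x => moment 0 x t) (- moment 1 theta t).
  have Ha : is_derive theta 1 (fun x : R => - ((rad x - mu) * t)) (- (t / rad theta)).
    apply: (is_derive_eq (is_deriveN (is_deriveM (is_deriveB Hr (is_derive_cst mu
      theta 1)) (is_derive_cst t theta 1)))).
    by rewrite scaler0 add0r /GRing.scale /= subr0.
  apply: (is_derive_eq (@is_derive1_comp R expR (fun x => - ((rad x - mu) * t))
    theta _ _ (is_derive_expR _) Ha)).
  by rewrite moment1 moment0 mulrN mulrC.
have H1 : is_derive theta 1 (fun x => moment 1 x t) (- moment 2 theta t).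
  apply: (is_derive_eq (is_deriveM (is_deriveZ t HV) H0)).
  rewrite momentSS moment1 !scaleRE /= !scaleRE.
  by rewrite muln0 add0n; field.
suff : is_derive theta 1 (fun x => moment i x t) (- moment i.+1 theta t) /\
       is_derive theta 1 (fun x => moment i.+1 x t) (- moment i.+2 theta t) by case.
elim: i => [|i [IH1 IH2]]; first by split.
split; first exact: IH2.
have HV2 : is_derive theta 1 (fun x => (rad x ^+ 2)^-1) (- 2 / rad theta ^+ 4).
  have HX : is_derive theta 1 (fun x => rad x ^+ 2) 2.
    apply: (is_derive_eq (is_deriveM Hr Hr)).
    by transitivity (rad theta / rad theta + rad theta / rad theta); [by []|field].
  have X0 : rad theta ^+ 2 != 0 by exact: expf_neq0.
  apply: (is_derive_eq (@is_deriveV R (fun x => rad x ^+ 2) theta _ 1 X0 HX)).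
  by transitivity (- (rad theta ^+ 2) ^- 2 * 2); [by []|field].
apply: (is_derive_eq (is_derive_recurrence (2 * i + 1)%:R IH1 IH2 (is_derive_cst (t
  ^+ 2) theta 1) HV2)).
rewrite !momentSS /=.
have -> : (2 * i.+1 + 1)%:R = (2 * i + 1)%:R + 2 :> R by rewrite !natrD !natrM
  -natr1; ring.
by field.
Qed.

Lemma moment0_is_derive (theta t : R) :
  is_derive t 1 (moment 0 theta) ((mu - rad theta) * moment 0 theta t).
Proof.
have Ha : is_derive t 1 (fun t : R => - ((rad theta - mu) * t)) (mu - rad theta).
  apply: (is_derive_eq (is_deriveN (is_deriveZ (rad theta - mu) (is_derive_id t 1)))).
  by transitivity (- ((rad theta - mu) * 1)); [by []|ring].
apply: (is_derive_eq (@is_derive1_comp R expR (fun t => - ((rad theta - mu) * t)) t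
  _ _ (is_derive_expR _) Ha)).
by rewrite moment0 mulrC.
Qed.

(** What the passage density f(s, t) suggests: its t-derivative is (mu + 1/t - t/s) f, and
    integrating this against s^(i+1) exp (- theta s) gives the formula. Division by s lowers the
    power, so index 0 needs its own derivative. *)
Definition moment_dt i theta t :=
  mu * moment i.+1 theta t + moment i.+1 theta t / t - t * moment i theta t.

Lemma moment_is_derive (theta t : R) i : 0 < theta -> 0 < t ->
  is_derive t 1 (moment i.+1 theta) (moment_dt i theta t).
Proof.
move=> th0 t0; have r0 := rad_gt0 th0.
have rn0 : rad theta != 0 by rewrite gt_eqF.
have tn0 : t != 0 by rewrite gt_eqF.
have H0 := moment0_is_derive theta t.
have Hid := is_derive_id t (1 : R).
have HX : is_derive t 1 (fun t : R => t ^+ 2) (2 * t).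
  apply: (is_derive_eq (is_deriveM Hid Hid)).
  by transitivity (t * 1 + t * 1); [by []|ring].
have HV : is_derive t 1 (fun _ : R => (rad theta ^+ 2)^-1) 0 by exact: is_derive_cst.
have H1 : is_derive t 1 (moment 1 theta) (moment_dt 0 theta t).
  have Ht : is_derive t 1 (fun t => t / rad theta) (rad theta)^-1.
    apply: (is_derive_eq (is_deriveM Hid (is_derive_cst ((rad theta)^-1) t (1 : R)))).
    by transitivity (t * 0 + (rad theta)^-1 * 1); [by []|ring].
  apply: (is_derive_eq (is_deriveM Ht H0)).
  transitivity (t / rad theta * ((mu - rad theta) * moment 0 theta t) + moment 0
    theta t * (rad theta)^-1); first by [].
  by rewrite /moment_dt moment1; field; rewrite ?rn0 ?tn0.
suff : is_derive t 1 (moment i.+1 theta) (moment_dt i theta t) /\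
       is_derive t 1 (moment i.+2 theta) (moment_dt i.+1 theta t) by case.
elim: i => [|i [IH1 IH2]]; split; [exact: H1| |exact: IH2|].
  apply: (is_derive_eq (is_derive_recurrence (2 * 0 + 1)%:R H0 H1 HX HV)).
  rewrite /moment_dt momentSS moment1 muln0 add0n.
  by field; rewrite ?rn0 ?tn0.
apply: (is_derive_eq (is_derive_recurrence (2 * i.+1 + 1)%:R IH1 IH2 HX HV)).
rewrite /moment_dt !momentSS.
have -> : (2 * i.+1 + 1)%:R = (2 * i + 1)%:R + 2 :> R by rewrite !natrD !natrM
  -natr1; ring.
by field; rewrite ?rn0 ?tn0.
Qed.

(** For i = 0, mu - rad is a root of x^2 - 2 mu x = 2 theta. Formally, i differentiations in - theta
    of that equation create the term - 2 i h_{i-1} by Leibniz; the proof checks the outcome from the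
    recursion. At i = 0 the meaningless [i.-1] carries the factor 0. *)
Lemma moment_ode (theta : R) i : 0 < theta -> exists m' : R -> R,
  (forall t : R, 0 < t -> is_derive t 1 (moment i theta) (m' t)) /\
  (forall t : R, 0 < t -> is_derive t 1 m'
     (2 * mu * m' t + 2 * theta * moment i theta t - 2 * i%:R * moment i.-1 theta t)).
Proof.
move=> th0; have r0 := rad_gt0 th0.
have rn0 : rad theta != 0 by rewrite gt_eqF.
case: i => [|i].
  exists (fun t => (mu - rad theta) * moment 0 theta t); split => t t0.
    exact: moment0_is_derive.
  apply: (is_derive_eq (is_deriveZ (mu - rad theta) (moment0_is_derive theta t))).
  transitivity ((mu - rad theta) * ((mu - rad theta) * moment 0 theta t)); first by [].
  have {1}-> : 2 * theta = rad theta ^+ 2 - mu ^+ 2 by rewrite rad_sqr//; ring.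
  by ring.
exists (moment_dt i theta); split => t t0; first exact: moment_is_derive.
have tn0 : t != 0 by rewrite gt_eqF.
have Hid := is_derive_id t (1 : R).
have HtV : is_derive t 1 (fun y : R => y^-1) (- t ^- 2).
  apply: (is_derive_eq (@is_deriveV R id t _ 1 tn0 Hid)).
  by transitivity (- t ^- 2 * 1); [by []|rewrite mulr1].
have H1 := moment_is_derive i th0 t0.
(* The derivative of [moment i] is left open because it has a different formula for i = 0 and for i
   > 0. *)
have key m0' : is_derive t 1 (moment i theta) m0' ->
   is_derive t 1 (moment_dt i theta) (mu * moment_dt i theta t +
    (moment_dt i theta t / t - moment i.+1 theta t / t ^+ 2) - (moment i theta t +
      t * m0')).
  move=> H0.
  apply: (is_derive_eq (is_deriveB (is_deriveD (is_deriveZ mu H1) (is_deriveM H1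
    HtV)) (is_deriveM Hid H0))).
  transitivity (mu * moment_dt i theta t + (moment i.+1 theta t * (- t ^- 2) + t^-1
    * moment_dt i theta t)
    - (t * m0' + moment i theta t * 1)); first by [].
  by ring.
have -> : 2 * theta = rad theta ^+ 2 - mu ^+ 2 by rewrite rad_sqr//; ring.
case: i H1 key => [|i] H1 key.
  apply: (is_derive_eq (key _ (moment0_is_derive theta t))).
  rewrite /moment_dt moment1.
  by field; rewrite ?rn0 ?tn0.
apply: (is_derive_eq (key _ (moment_is_derive i th0 t0))).
rewrite /moment_dt !momentSS /=.
(* Expresses the index through the coefficient of the recursion, so that [field] sees a single
   atom. *)
have -> : i.+2%:R = ((2 * i + 1)%:R + 3) / 2 :> R.
  by rewrite [(2 * i + 1)%:R]natrD natrM -[i.+2]addn2 natrD; field.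
by field; rewrite ?rn0 ?tn0.
Qed.
End moments.

(** * Moments as derivatives of the Laplace transform *)

Section laplace_moments.
Context d (T : measurableType d) (R : realType) (P : probability T R).
Variables (Z : T -> \bar R) (mu t : R).
Hypotheses (mZ : measurable_fun [set: T] Z) (Z0 : forall w, (0 <= Z w)%E).
Hypothesis laplaceZ : forall theta, 0 < theta ->
  (\int[P]_w (on_finite (fun z => expR (- (theta * z))) (Z w))%:E =
   (expR (- ((rad mu theta - mu) * t)))%:E)%E.

Definition damped_power i (theta z : R) : R := z ^+ i * expR (- (theta * z)).
Definition damped_powerZ i theta w := on_finite (damped_power i theta) (Z w).

(** From y <= exp y at y = theta z / i, raised to the power i. The bound is free of z and decreases
    in theta, so it dominates uniformly on a half-line of theta. *)
Lemma damped_power_le i (theta z : R) : 0 < theta -> 0 <= z ->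
  damped_power i theta z <= (i%:R / theta) ^+ i.
Proof.
move=> th0 z0; rewrite /damped_power.
case: i => [|i].
  by rewrite !expr0 mul1r -expR0 ler_expR oppr_le0 mulr_ge0// ltW.
rewrite expRN ler_pdivrMr ?expR_gt0//.
have i0 : 0 < i.+1%:R :> R by [].
have E : expR (theta * z) = expR (theta * z / i.+1%:R) ^+ i.+1.
  by rewrite -expRM_natl; congr expR; rewrite [RHS]mulrC divfK// gt_eqF.
rewrite E -exprMn lerXn2r ?nnegrE ?mulr_ge0 ?expR_ge0 ?invr_ge0 ?(ltW th0)//.
apply: (@le_trans _ _ (i.+1%:R / theta * (theta * z / i.+1%:R))).
  by rewrite le_eqVlt; apply/orP; left; apply/eqP; rewrite -[theta * z * _]mulrA [z
    * _]mulrC mulrA divfK ?gt_eqF// mulrA divff ?mul1r ?gt_eqF.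
apply: ler_wpM2l; first by rewrite divr_ge0// ltW.
by apply: le_trans (expR_ge1Dx _); rewrite lerDr.
Qed.

Lemma damped_power_ge0 i (theta z : R) : 0 <= z -> 0 <= damped_power i theta z.
Proof. by move=> z0; rewrite mulr_ge0 ?exprn_ge0 ?expR_ge0. Qed.

Lemma damped_powerZ_measurable i theta : measurable_fun [set: T] (damped_powerZ i
  theta).
Proof.
apply: (measurableT_comp (on_finite_measurable _) mZ).
apply: measurable_funM; first exact: measurable_funX.
by apply: measurableT_comp => //; apply: measurableT_comp => //; exact: measurable_funM.
Qed.

Lemma damped_powerZ_bound i theta w : 0 < theta ->
  0 <= damped_powerZ i theta w <= (i%:R / theta) ^+ i.
Proof.
move=> th0; have C0 : 0 <= (i%:R / theta) ^+ i by rewrite exprn_ge0// divr_ge0// ltW.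
have := Z0 w; rewrite /damped_powerZ; case: (Z w) => [z| |]//=.
  by rewrite lee_fin => z0; rewrite damped_power_ge0// damped_power_le.
by rewrite lexx C0.
Qed.

Lemma damped_powerZ_integrable i theta : 0 < theta ->
  P.-integrable [set: T] (EFin \o damped_powerZ i theta).
Proof.
move=> th0; apply: measurable_bounded_integrable => //.
- by apply: (le_lt_trans (probability_le1 P measurableT)); exact: ltry.
- exact: damped_powerZ_measurable.
- exists ((i%:R / theta) ^+ i); split; first exact: num_real.
  move=> x Cx w _; have /andP[f0 f1] := damped_powerZ_bound i w th0.
  by rewrite /= ger0_norm// (le_trans f1)// ltW.
Qed.

Lemma damped_power_is_derive i (theta z : R) :
  is_derive theta 1 (fun x => damped_power i x z) (- damped_power i.+1 theta z).
Proof.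
have Ha : is_derive theta 1 (fun x : R => - (x * z)) (- z).
  apply: (is_derive_eq (is_deriveN (is_deriveM (is_derive_id theta (1 : R))
    (is_derive_cst z theta (1 : R))))).
  by transitivity (- (theta * 0 + z * 1)); [by []|ring].
have He := @is_derive1_comp R expR (fun x => - (x * z)) theta _ _ (is_derive_expR _) Ha.
apply: (is_derive_eq (is_deriveZ (z ^+ i) He)).
transitivity (z ^+ i * (expR (- (theta * z)) * - z)); first by [].
by rewrite /damped_power exprS; ring.
Qed.

Lemma damped_powerZ_is_derive i (theta : R) w :
  is_derive theta 1 (fun x => damped_powerZ i x w) (- damped_powerZ i.+1 theta w).
Proof.
rewrite /damped_powerZ; case: (Z w) => [z| |] /=; first exact: damped_power_is_derive.
- by rewrite oppr0; exact: is_derive_cst.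
- by rewrite oppr0; exact: is_derive_cst.
Qed.

(** Each derivative in theta brings down a factor - Z under the integral and, by
    [moment_is_derive_theta], turns [moment i] into minus its successor. *)
Lemma Rintegral_damped_powerZ i theta : 0 < theta ->
  \int[P]_w damped_powerZ i theta w = moment mu i theta t.
Proof.
elim: i theta => [|i IH] theta th0.
  rewrite /Rintegral.
  under eq_integral.
    move=> w _.
    rewrite (_ : damped_powerZ 0 theta w = on_finite (fun z => expR (- (theta *
      z))) (Z w)); last first.
      by rewrite /damped_powerZ /damped_power; case: (Z w) => //= z;
        rewrite expr0 mul1r.
    over.
  by rewrite laplaceZ.
have partialE x w : partial1of2 (damped_powerZ i) x w = - damped_powerZ i.+1 x w.
  by rewrite partial1of2E; have := damped_powerZ_is_derive i x w; case.
(* The dominating constant blows up at 0, so theta is kept above [u], where the bound is [C]. *)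
pose u := theta / 2.
have u0 : 0 < u by rewrite divr_gt0.
have uth : u < theta by rewrite ltr_pdivrMr// ltr_pMr// ltr1n.
pose C := (i.+1%:R / u) ^+ i.+1.
have C0 : 0 <= C by rewrite exprn_ge0// divr_ge0// ltW.
have Hd := @differentiation_under_integral R _ _ P (damped_powerZ i) setT
  measurableT theta u (theta + 1).
have {}Hd : (fun x => \int[P]_w damped_powerZ i x w)^`()%classic theta =
    \int[P]_w partial1of2 (damped_powerZ i) theta w.
  apply: (Hd _ _ _ (fun=> C)).
  - by rewrite /= in_itv/= uth ltrDl ltr01.
  - move=> x; rewrite /= in_itv/= => /andP[ux _].
    by apply: damped_powerZ_integrable; exact: lt_trans ux.
  - by move=> x w _ _; have := damped_powerZ_is_derive i x w; case.
  - by [].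
  - apply: measurable_bounded_integrable => //.
      by apply: (le_lt_trans (probability_le1 P measurableT)); exact: ltry.
    by exists C; split; [exact: num_real|move=> y Cy w _ /=; rewrite ger0_norm// ltW].
  - move=> x w; rewrite /= in_itv/= => /andP[ux _] _.
    have x0 := lt_trans u0 ux.
    rewrite partialE normrN; have /andP[f0 f1] := damped_powerZ_bound i.+1 w x0.
    rewrite ger0_norm//; apply: (le_trans f1).
    rewrite lerXn2r ?nnegrE ?divr_ge0 ?(ltW x0) ?(ltW th0)//.
    by rewrite ler_wpM2l// lef_pV2 ?posrE// ltW.
have : (fun x => \int[P]_w damped_powerZ i x w)^`()%classic theta = - moment mu
  i.+1 theta t.
  rewrite derive1E.
  have Hm := moment_is_derive_theta mu i t th0.
  rewrite -(@derive_val _ _ _ _ _ _ _ Hm).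
  by apply: near_eq_derive; near=> x; apply: IH; near: x; exact: lt_nbhsr.
rewrite Hd => H; apply: oppr_inj; rewrite -H.
under [RHS]eq_Rintegral do rewrite partialE.
rewrite -mulN1r -RintegralZl//; last exact: damped_powerZ_integrable.
by apply: eq_Rintegral => w _; rewrite mulN1r.
Unshelve. all: by end_near. Qed.
End laplace_moments.

(** * Subordination and the differential equation *)

Section subordination.
Context d (T : measurableType d) (R : realType) (P : probability T R).
Variables (k : nat) (lambda : nat -> R) (M : R -> T -> nat) (B : R -> T -> R).
Hypotheses (M_gcp : generalized_counting_process P k lambda M)
  (B_process : is_process B) (MB_indep : independent_processes P M B).
Variable Z : T -> \bar R.
Hypotheses (Z_gt0 : forall w, (0 < Z w)%E)
  (Z_sigma : forall s : R, sigma_process B [set w | (Z w <= s%:E)%E]).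

Definition cell (m i : nat) : set T :=
  [set w | (i%:R / m.+1%:R)%:E < Z w]%E `&` [set w | Z w <= (i.+1%:R / m.+1%:R)%:E]%E.
(* To the right of every point of the cell, so that right-continuity applies. *)
Definition cell_time (m i : nat) : R := i.+2%:R / m.+1%:R.

Lemma cell_sigma m i : sigma_process B (cell m i).
Proof.
apply: (@measurableI _ (g_sigma_algebraType _)); last exact: Z_sigma.
rewrite (_ : [set w | _] = ~` [set w | (Z w <= (i%:R / m.+1%:R)%:E)%E]).
  by apply: (@measurableC _ (g_sigma_algebraType _)); exact: Z_sigma.
by apply/seteqP; split => w /=; [move=> h; apply/negP; rewrite -ltNge|move/negP;
  rewrite -ltNge].
Qed.

Lemma cell_measurable m i : measurable (cell m i).
Proof. by apply: (sigma_process_measurable B_process); exact: cell_sigma. Qed.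

Lemma cell_inj m i j w : cell m i w -> cell m j w -> i = j.
Proof.
wlog ij : i j / (i <= j)%N.
  by move=> H hi hj; have [/H->//|/ltnW/H] := leqP i j; move=> /(_ hj hi).
move=> [_ /= Zi] [Zj _]; apply/eqP; rewrite eqn_leq ij /= leqNgt; apply/negP => ij'.
have := lt_le_trans Zj Zi; rewrite lte_fin ltr_pM2r ?invr_gt0// ltr_nat.
by rewrite ltnNge ij'.
Qed.

(** Enough cells to cover (0, m + 1], so every finite value of [Z] is eventually caught. *)
Definition cells (m : nat) := (m.+1 ^ 2)%N.

(** [phi] at the rounded [Z], and 0 beyond the last cell. It is generic because the same rounding
    serves the random indicator of M(s) = n and the deterministic probability of that event. *)
Definition grid_value (phi : R -> T -> R) m w : R :=
  \sum_(i < cells m) \1_(cell m i) w * phi (cell_time m i) w.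

Lemma grid_value_cell phi m i w : (i < cells m)%N -> cell m i w ->
  grid_value phi m w = phi (cell_time m i) w.
Proof.
move=> im wi; rewrite /grid_value (bigD1 (Ordinal im))//= big1 ?addr0.
  by rewrite indicE mem_set// mul1r.
move=> j ji; rewrite indicE memNset ?mul0r// => wj.
by move/eqP : ji; apply; apply/val_inj => /=; exact: cell_inj wj wi.
Qed.

Lemma grid_value_le1 phi m w : (forall s, 0 <= s -> 0 <= phi s w <= 1) ->
  0 <= grid_value phi m w <= 1.
Proof.
move=> phi01; have [[i im wi]|no] := pselect (exists2 i, (i < cells m)%N & cell m i w).
  by rewrite (grid_value_cell _ im wi) phi01// divr_ge0.
rewrite /grid_value big1 ?lexx ?ler01// => i _; rewrite indicE memNset ?mul0r// => wi.
by apply: no; exists i.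
Qed.

Lemma grid_value_cvg phi (l : R) w z : Z w = z%:E -> phi s w @[s --> z^'+] --> l ->
  grid_value phi m w @[m --> \oo] --> l.
Proof.
move=> Zw phil.
have z0 : 0 < z by have := Z_gt0 w; rewrite Zw lte_fin.
apply/cvgrPdist_le => /= e e0.
have /cvgrPdist_le /(_ e e0) := phil.
rewrite /at_right near_withinE => -[rho /= rho0 H].
(* The first bound puts [z] within the covered range; the second brings the sampling time, less than
   two mesh widths after [z], within [rho] of it. *)
exists (maxn (Num.truncn z) (Num.truncn (2 / rho))) => // m /=.
rewrite geq_max => /andP[mz mrho].
have m0 : 0 < m.+1%:R :> R by [].
have zm : z < m.+1%:R.
  by apply: lt_le_trans (Num.Theory.truncnS_gt _) _; rewrite ler_nat.
have rhom : 2 / rho < m.+1%:R.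
  by apply: lt_le_trans (Num.Theory.truncnS_gt _) _; rewrite ler_nat.
have ex : exists j : nat, z * m.+1%:R <= j%:R.
  by exists (Num.truncn (z * m.+1%:R)).+1; exact/ltW/Num.Theory.truncnS_gt.
case: (ex_minnP ex) => -[|i] zi mini.
  by move: zi; rewrite leNgt mulr_gt0.
have iz : i%:R < z * m.+1%:R.
  by rewrite ltNge; apply/negP => /mini; rewrite ltnn.
have wi : cell m i w.
  by split; rewrite /= Zw ?lte_fin ?lee_fin ?ltr_pdivrMr// ler_pdivlMr.
have im : (i < cells m)%N.
  rewrite -(ltr_nat R) (lt_le_trans iz)// /cells natrX expr2 ler_wpM2r//.
  exact: ltW.
have zt : z < cell_time m i.
  by rewrite ltr_pdivlMr// (le_lt_trans zi)// ltr_nat.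
rewrite (grid_value_cell _ im wi); apply: H => //=.
rewrite distrC gtr0_norm ?subr_gt0// ltrBlDr ltr_pdivrMr// -addn2 natrD mulrDl.
by rewrite addrC ltrD// -ltr_pdivrMl// mulrC.
Qed.

Lemma grid_value_infinite phi m w : Z w = +oo%E -> grid_value phi m w = 0.
Proof.
by move=> Zw; rewrite /grid_value big1// => i _; rewrite indicE memNset ?mul0r//=
  => -[_ /=]; rewrite Zw.
Qed.

Variable n : nat.
Definition state_indic s w : R := \1_[set w | M s w = n] w.
Definition subordinated_event := [set w | (Z w < +oo)%E /\ M (fine (Z w)) w = n].

Lemma state_measurable s : 0 <= s -> measurable [set w | M s w = n].
Proof. by move=> s0; exact: (M_event_measurable M_gcp [set n] s0). Qed.

Lemma cell_time_ge0 m i : 0 <= cell_time m i. Proof. by rewrite divr_ge0. Qed.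

Lemma grid_value_measurable (phi : R -> T -> R) m :
  (forall s, 0 <= s -> measurable_fun [set: T] (phi s)) ->
  measurable_fun [set: T] (grid_value phi m).
Proof.
move=> mphi; apply: measurable_sum => i; apply: measurable_funM.
  by apply: measurable_indic; exact: cell_measurable.
exact: mphi (cell_time_ge0 m i).
Qed.

Lemma state_indic_measurable s : 0 <= s -> measurable_fun [set: T] (state_indic s).
Proof. by move=> s0; apply: measurable_indic; exact: state_measurable. Qed.

Lemma state_indic_bound s w : 0 <= state_indic s w <= 1.
Proof. by rewrite /state_indic indicE; case: (_ \in _); rewrite lexx ler01. Qed.

(** On one cell the sampling time is deterministic, so the state event belongs to M and the cell to
    B, and independence factors the probability. *)
Lemma integral_grid_value m :
  (\int[P]_w (grid_value state_indic m w)%:E =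
   \int[P]_w (grid_value (fun s _ => pmf P M n s) m w)%:E)%E.
Proof.
rewrite /grid_value; under eq_integral do rewrite -sumEFin.
under [RHS]eq_integral do rewrite -sumEFin.
have mc i : measurable_fun [set: T] (\1_(cell m i) : T -> R).
  by apply: measurable_indic; exact: cell_measurable.
rewrite !ge0_integral_sum//; last 4 first.
- by move=> i; apply/measurable_EFinP; exact: measurable_funM.
- by move=> i w _; rewrite lee_fin mulr_ge0// pmf_ge0.
- move=> i; apply/measurable_EFinP; apply: measurable_funM => //.
  by apply: state_indic_measurable; exact: cell_time_ge0.
- by move=> i w _; rewrite lee_fin mulr_ge0//; have /andP[] :=
  state_indic_bound (cell_time m i) w.
apply: eq_bigr => i _.
have c0 := cell_time_ge0 m i.
under eq_integral.
  move=> w _; rewrite /state_indic -[_ * _]/((\1_(cell m i) \* \1_[set w | M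
    (cell_time m i) w = n]) w) -indicI.
  over.
under [RHS]eq_integral do rewrite EFinM.
rewrite integral_indic//; last by apply: measurableI;
  [exact: cell_measurable|exact: state_measurable].
rewrite setIT ge0_integralZr//; last 2 first.
- exact/measurable_EFinP.
- by rewrite lee_fin pmf_ge0.
rewrite integral_indic//; last exact: cell_measurable.
rewrite setIT -(pmfE M_gcp)// setIC muleC.
apply: MB_indep; last exact: cell_sigma.
apply: sub_gen_smallest; exists (cell_time m i) => //; exists [set n] => //.
by rewrite setTI.
Qed.

Lemma state_indic_right_cvg z w : 0 < z ->
  state_indic s w @[s --> z^'+] --> state_indic z w.
Proof.
move=> z0; have [_ [_ _ _ _ cad] _] := M_gcp.
(* Integers at distance less than 1 coincide, so right-continuity makes the state constant just
   after [z]. *)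
have /cvgrPdist_lt /(_ 1 ltr01) Mr := (cad w).1 z (ltW z0).
apply: (cvg_trans (near_eq_cvg _) (cvg_cst (state_indic z w))).
apply: filterS Mr => s.
rewrite /= ltr_distl ltrBlDr !natr1 !ltr_nat !ltnS => /andP[h1 h2].
have E : M z w = M s w by apply/eqP; rewrite eqn_leq h1 h2.
rewrite /state_indic !indicE; congr (nat_of_bool _)%:R.
by apply/asboolP/asboolP; rewrite /= E.
Qed.

Lemma pmf_right_cvg z : 0 < z -> pmf P M n s @[s --> z^'+] --> pmf P M n z.
Proof.
move=> z0; apply: cvg_at_right_filter.
have H := pmf_is_derive M_gcp n z0.
by apply: differentiable_continuous; apply/derivable1_diffP; case: H.
Qed.

Definition subordinated_indic w : R := \1_subordinated_event w.

Lemma grid_state_cvg w : grid_value state_indic m w @[m --> \oo] -->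
  subordinated_indic w.
Proof.
have := Z_gt0 w; case Zw : (Z w) => [z| |]//; rewrite ?lte_fin => z0.
  rewrite (_ : subordinated_indic w = state_indic z w).
    by apply: (@grid_value_cvg state_indic _ _ _ Zw); exact: state_indic_right_cvg.
  rewrite /subordinated_indic /state_indic !indicE /subordinated_event.
  by congr (nat_of_bool _)%:R; apply/asboolP/asboolP; rewrite /= Zw /= ltry => // -[].
rewrite (_ : subordinated_indic w = 0).
  by under eq_fun do rewrite (grid_value_infinite _ _ Zw); exact: cvg_cst.
by rewrite /subordinated_indic indicE memNset// /subordinated_event /= Zw ltxx => -[].
Qed.

Lemma grid_pmf_cvg w : grid_value (fun s _ => pmf P M n s) m w @[m --> \oo] -->
  on_finite (pmf P M n) (Z w).
Proof.
have := Z_gt0 w; case Zw : (Z w) => [z| |]//; rewrite ?lte_fin => z0.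
  by apply: (@grid_value_cvg (fun s _ => pmf P M n s) _ _ _ Zw); exact: pmf_right_cvg.
by under eq_fun do rewrite (grid_value_infinite _ _ Zw); exact: cvg_cst.
Qed.

Lemma grid_integral_cvg (phi : R -> T -> R) (f : T -> R) :
  (forall s, 0 <= s -> measurable_fun [set: T] (phi s)) ->
  (forall s w, 0 <= s -> 0 <= phi s w <= 1) ->
  (forall w, grid_value phi m w @[m --> \oo] --> f w) ->
  measurable_fun [set: T] f /\
  (\int[P]_w (grid_value phi m w)%:E)%E @[m --> \oo] --> (\int[P]_w (f w)%:E)%E.
Proof.
move=> mphi phi01 phif.
have mg m : measurable_fun [set: T] (grid_value phi m) by exact: grid_value_measurable.
have mf : measurable_fun [set: T] f.
  by apply: (measurable_fun_cvg mg) => w _; exact: phif.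
split => //.
have [] := @dominated_convergence _ T R P setT measurableT (fun m w => (grid_value
  phi m w)%:E)
  (EFin \o f) (cst 1%E).
- by move=> m; exact/measurable_EFinP.
- exact/measurable_EFinP.
- by apply: aeW => w _ /=; apply: cvg_EFin; [exact: nearW|exact: phif].
- by apply: finite_measure_integrable_cst.
- apply: aeW => w m _ /=; rewrite lee_fin.
  by have /andP[g0 g1] := @grid_value_le1 phi m w (fun s => phi01 s w);
    rewrite ger0_norm.
- by [].
Qed.

(** M at a random time is not measurable a priori; the event is, because its indicator is a
    pointwise limit of grid values. The formula compares the limits of two sequences of integrals
    that coincide by [integral_grid_value]. *)
Lemma subordinated_prob : measurable subordinated_event /\
  P subordinated_event = (\int[P]_w (on_finite (pmf P M n) (Z w))%:E)%E.
Proof.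
have [m1 c1] := grid_integral_cvg state_indic_measurable (fun s w _ =>
  state_indic_bound s w) grid_state_cvg.
have [|s w s0|_ c2] := @grid_integral_cvg (fun s _ => pmf P M n s) _ _ _ grid_pmf_cvg.
- by move=> s _; exact: measurable_cst.
- by rewrite pmf_ge0 (pmf_le1 M_gcp).
have mE : measurable subordinated_event.
  rewrite (_ : subordinated_event = subordinated_indic @^-1` [set 1]).
    by rewrite -[X in measurable X]setTI; exact: m1.
  apply/seteqP; split => w; rewrite /= /subordinated_indic indicE.
    by move=> h; rewrite mem_set.
  by have [//|h] := pselect (subordinated_event w); rewrite memNset// => /esym/eqP;
    rewrite oner_eq0.
split => //.
rewrite -[LHS](_ : (\int[P]_w (subordinated_indic w)%:E)%E = _);
  last by rewrite integral_indic// setIT.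
apply: (cvg_unique _ c1) => //.
have E : (fun m => (\int[P]_w (grid_value state_indic m w)%:E)%E) =
    (fun m => (\int[P]_w (grid_value (fun s _ => pmf P M n s) m w)%:E)%E).
  by apply/funext => m; exact: integral_grid_value.
by rewrite /= E.
Qed.
End subordination.

(** * The differential equation for polynomial moments *)

Section moment_functional.
Context (R : realType) (mu theta : R).
Hypothesis theta0 : 0 < theta.

(** The closed form of E[p(Z) exp (- theta Z)], linear in [p]. *)
Definition moment_poly (p : {poly R}) (t : R) : R :=
  \sum_(i < size p) p`_i * moment mu i theta t.

Lemma moment_poly_widen (p : {poly R}) N t : (size p <= N)%N ->
  moment_poly p t = \sum_(i < N) p`_i * moment mu i theta t.
Proof.
move=> pN; rewrite /moment_poly (big_ord_widen N (fun i => p`_i * moment mu i theta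
  t) pN).
rewrite big_mkcond; apply: eq_bigr => i _; case: ltnP => // pi.
by rewrite nth_default// mul0r.
Qed.

Lemma moment_polyD p q t : moment_poly (p + q) t = moment_poly p t + moment_poly q t.
Proof.
have [Np Nq] := (leq_maxl (size p) (size q), leq_maxr (size p) (size q)).
rewrite (moment_poly_widen t (size_polyD p q)) (moment_poly_widen t Np)
  (moment_poly_widen t Nq).
by rewrite -big_split; apply: eq_bigr => i _; rewrite coefD mulrDl.
Qed.

Lemma moment_polyZ c p t : moment_poly (c *: p) t = c * moment_poly p t.
Proof.
rewrite (moment_poly_widen t (size_scale_leq c p)) mulr_sumr.
by apply: eq_bigr => i _; rewrite coefZ mulrA.
Qed.

Lemma moment_poly_sum (I : Type) (r : seq I) (c : I -> R) (q : I -> {poly R}) t :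
  moment_poly (\sum_(j <- r) c j *: q j) t = \sum_(j <- r) c j * moment_poly (q j) t.
Proof.
elim/big_rec2: _ => [|j y1 y2 _ <-]; first by rewrite /moment_poly size_poly0 big_ord0.
by rewrite moment_polyD moment_polyZ.
Qed.

(** Identifies the terms i h_{i-1} of [moment_ode] as the functional applied to the derivative of
    [p]. *)
Lemma moment_poly_deriv p t :
  moment_poly p^`() t = \sum_(i < size p) p`_i * (i%:R * moment mu i.-1 theta t).
Proof.
have [->|p0] := eqVneq p 0; first by rewrite deriv0 /moment_poly size_poly0 !big_ord0.
have ps : size p = (size p).-1.+1 by rewrite prednK// size_poly_gt0.
rewrite (@moment_poly_widen _ (size p).-1); last first.
  by rewrite -ltnS -ps lt_size_deriv.
rewrite [in RHS]ps big_ord_recl mul0r mulr0 add0r.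
by apply: eq_bigr => i _; rewrite coef_deriv /= -[_ *+ _]mulr_natr -mulrA.
Qed.

Lemma moment_poly_ode (p : {poly R}) : exists D : R -> R,
  (forall t : R, 0 < t -> is_derive t 1 (moment_poly p) (D t)) /\
  (forall t : R, 0 < t -> is_derive t 1 D
     (2 * mu * D t + 2 * theta * moment_poly p t - 2 * moment_poly p^`() t)).
Proof.
have /boolp.choice[m' Hm'] := fun i => moment_ode mu i theta0.
exists (fun t => \sum_(i < size p) p`_i * m' i t); split => t t0.
  exact: (@is_derive_lincomb _ (size p) (fun i => p`_i) (fun i => moment mu i theta)
    (fun i => m' i t) t (fun i => (Hm' i).1 t t0)).
have := @is_derive_lincomb _ (size p) (fun i => p`_i) m' _ t (fun i => (Hm' i).2 t t0).
move=> H; apply: (is_derive_eq H).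
rewrite moment_poly_deriv /moment_poly !mulr_sumr -big_split -sumrB /=.
by apply: eq_bigr => i _; ring.
Qed.
End moment_functional.

Lemma Rintegral_lincomb d (T : measurableType d) (R : realType) (m : {measure set T
  -> \bar R})
    N (c : nat -> R) (f : nat -> T -> R) :
  (forall i, m.-integrable [set: T] (EFin \o f i)) ->
  \int[m]_w (\sum_(i < N) c i * f i w) = \sum_(i < N) c i * \int[m]_w f i w.
Proof.
move=> fi; suff [] : m.-integrable [set: T] (EFin \o (fun w => \sum_(i < N) c i * f
  i w)) /\
  \int[m]_w (\sum_(i < N) c i * f i w) = \sum_(i < N) c i * \int[m]_w f i w by [].
elim: N => [|N [IHi IH]].
  rewrite big_ord0 (_ : (fun w => _) = cst 0); last by apply/funext => w;
    rewrite big_ord0.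
  by split; [exact: integrable0|rewrite /Rintegral integral0].
have ci : m.-integrable [set: T] (EFin \o (fun w => c N * f N w)).
  by have := integrableZl measurableT (c N) (fi N).
have -> : (fun w => \sum_(i < N.+1) c i * f i w) = (fun w => \sum_(i < N) c i * f i
  w + c N * f N w).
  by apply/funext => w; rewrite big_ord_recr.
split; first by have := integrableD measurableT IHi ci.
by rewrite RintegralD// IH big_ord_recr /= RintegralZl.
Qed.

Section first_passage_law.
Context (d : measure_display) (T : measurableType d) (R : realType)
    (P : probability T R) (k : nat) (lambda : nat -> R)
    (M : R -> T -> nat) (B : R -> T -> R) (mu : R).
Hypotheses (k_ge1 : (1 <= k)%N)
    (lambda_gt0 : forall j : nat, (1 <= j <= k)%N -> 0 < lambda j)
    (M_gcp : generalized_counting_process P k lambda M)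
    (B_bm : brownian_motion P B)
    (MB_indep : independent_processes P M B).
Notation Lam := (total_rate k lambda).

Lemma total_rate_gt0 : 0 < Lam.
Proof.
rewrite /total_rate big_nat_recl//= ltr_pwDl ?lambda_gt0//.
rewrite big_nat; apply: sumr_ge0 => j /andP[_ jk]; apply/ltW/lambda_gt0.
by rewrite /= -ltnS.
Qed.

Lemma first_passage_gt0 t w : 0 < t -> (0 < first_passage (drifted B mu) t w)%E.
Proof.
move=> t0; rewrite ltNge; apply/negP.
move/(first_passage_le t0 (drifted0 mu B_bm w) (@drifted_continuous _ _ _ _ _ mu
  B_bm w) (lexx 0)).
move=> [u u0]; rewrite (_ : u = 0); last by apply/eqP; rewrite eq_le andbC.
by rewrite (drifted0 mu B_bm w) leNgt t0.
Qed.

(** Both Laplace bounds combine into the transform, and the polynomial in the law of M is integrated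
    term by term; on Z = +oo every term is 0. *)
Lemma phat_moment_poly (Q : nat -> {poly R}) :
  (forall n s, 0 < s -> pmf P M n s = (Q n).[s] * expR (- (Lam * s))) ->
  forall n t, 0 < t -> phat P M B mu n t = moment_poly mu Lam (Q n) t.
Proof.
move=> HQ n t t0; have L0 := total_rate_gt0.
have [mB _ _ _ _] := B_bm.
pose Z := first_passage (drifted B mu) t.
have Z0 w : (0 < Z w)%E by exact: first_passage_gt0.
have [_ PE] := @subordinated_prob _ _ _ P k lambda M B M_gcp mB MB_indep Z Z0
   (fun s => first_passage_sigma mu B_bm s t0) n.
rewrite /phat -/Z -/(subordinated_event M Z n) PE.
have lapl theta : 0 < theta -> (\int[P]_w (on_finite (fun z => expR (- (theta *
  z))) (Z w))%:E =
   (expR (- ((rad mu theta - mu) * t)))%:E)%E.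
  move=> th0; apply/eqP; rewrite eq_le; apply/andP; split.
    exact: (passage_laplace_le mu B_bm th0 t0).
  exact: (passage_laplace_ge mu B_bm th0 t0).
have mZ : measurable_fun [set: T] Z by exact: (first_passage_measurable mu B_bm t0).
have HI := fun i => Rintegral_damped_powerZ mZ (fun w => ltW (Z0 w)) lapl i L0.
transitivity (\int[P]_w (\sum_(i < size (Q n)) (Q n)`_i * damped_powerZ Z i Lam w)).
  congr fine; apply: eq_integral => w _; congr (_%:E).
  rewrite /damped_powerZ; have := Z0 w; case: (Z w) => [z| |] //=; last first.
    by move=> _; rewrite big1// => i _; rewrite mulr0.
  rewrite lte_fin => z0; rewrite HQ// horner_coef mulr_suml.
  by apply: eq_bigr => i _; rewrite /damped_power mulrA.
rewrite (@Rintegral_lincomb _ _ _ P _ (fun i => (Q n)`_i) (fun i => damped_powerZ Z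
  i Lam)).
  by apply: eq_bigr => i _; rewrite HI.
by move=> i; apply: damped_powerZ_integrable => // w; exact: ltW.
Qed.
End first_passage_law.

Theorem theorem4p2 (d : measure_display) (T : measurableType d) (R : realType)
    (P : probability T R) (k : nat) (lambda : nat -> R)
    (M : R -> T -> nat) (B : R -> T -> R) (mu : R)
    (k_ge1 : (1 <= k)%N)
    (lambda_gt0 : forall j : nat, (1 <= j <= k)%N -> 0 < lambda j)
    (M_gcp : generalized_counting_process P k lambda M)
    (B_bm : brownian_motion P B)
    (MB_indep : independent_processes P M B)
    (n : nat) (t : R) (t_gt0 : 0 < t) :
  let p := phat P M B mu in
  [/\ derivable (p n) t 1,
      derivable ((p n)^`()%classic) t 1
    & (p n)^`(2)%classic t - 2 * mu * (p n)^`()%classic t =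
      2 * (total_rate k lambda * p n t -
           \sum_(1 <= j < (minn n k).+1) lambda j * p (n - j)%N t)].
Proof.
move=> p.
have L0 := total_rate_gt0 k_ge1 lambda_gt0.
have [Q [HQ Q']] := pmf_polys M_gcp.
have pE m s : 0 < s -> p m s = moment_poly mu (total_rate k lambda) (Q m) s.
  by move=> s0; apply: (phat_moment_poly mu k_ge1 lambda_gt0 M_gcp B_bm MB_indep HQ).
have [D [D1 D2]] := moment_poly_ode mu L0 (Q n).
(* The closed form of [p] is known only for t > 0; derivatives are local, so agreement near a
   positive time is enough. *)
have near_pos (f g : R -> R) (s : R) : 0 < s -> (forall x, 0 < x ->
  f x = g x) -> \near s, f s = g s.
  by move=> s0 fg; near=> x; apply: fg; near: x; exact: lt_nbhsr.
have p1 (s : R) : 0 < s -> is_derive s 1 (p n) (D s).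
  move=> s0; apply: near_eq_is_derive (D1 s s0).
  by apply: near_pos => // x x0; rewrite pE.
have p'E (s : R) : 0 < s -> (p n)^`()%classic s = D s.
  by move=> s0; rewrite derive1E; have := p1 s s0; case.
have p2 := near_eq_is_derive (near_pos _ _ t t_gt0 (fun x x0 => esym (p'E x x0)))
  (D2 t t_gt0).
split.
- by case: (p1 t t_gt0).
- by case: p2.
rewrite derive1nS derive1n1 derive1E p'E// (@derive_val _ _ _ _ _ _ _ p2).
(* The derivative of [Q n] becomes the sum over jumps: the forward equation for M turns into the
   right-hand side of the claim. *)
rewrite Q' moment_poly_sum -pE//.
under [in RHS]eq_bigr do rewrite pE//.
ring.
Unshelve. all: by end_near. Qed.
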